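(* Let $K$ be an algebraically closed field that is complete with respect to a nontrivial ultrametric norm $|\cdot|$, and suppose that the residue characteristic of $K$ is strictly positive. Then there is a polynomial of degree at least two with coefficients in $K$ having a nontrivial wandering Fatou component that is a rational disk.
   Context: Write $|K^{\times}| = \{|z| : z \in K^{\times}\}$. For $z_0 \in K$ and $r \in \mathbb{R}_{>0}$, the disk $\{z \in K : |z - z_0| < r\}$ is rational if $r \in |K^{\times}|$. A rational disk of the projective line $\mathbb{P}^1_K$ is the image of a rational disk of $K$ under a Möbius transformation. Let $\mathsf{P}^1_K$ denote the Berkovich projective line over $K$. A rational map $R$ of degree at least two with coefficients in $K$ acts on $\mathsf{P}^1_K$. The Fatou set of $R$ is the set of points of $\mathsf{P}^1_K$ having an open neighborhood $U$ such that $\bigcup_{n \ge 0} R^n(U)$ omits infinitely many points of $\mathsf{P}^1_K$; a Fatou component is a connected component of the Fatou set, and $R$ maps each Fatou component onto a Fatou component. A Fatou component $U$ is wandering if the sets $R^i(U)$, $i \ge 0$, are pairwise disjoint. A wandering Fatou component is trivial if it contains a point (of $\mathsf{P}^1_K$) whose forward orbit is asymptotic to a periodic orbit of $R$ in $\mathsf{P}^1_K$, and nontrivial otherwise. A Fatou component is said to be a rational disk if its intersection with $\mathbb{P}^1_K$ (the set of $K$-points) is one. *)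

(* Defs.v *)
From HB Require Import structures.
From mathcomp Require Import all_boot all_order all_algebra.
From mathcomp Require Import ring_quotient.
From mathcomp Require Import all_classical all_reals all_analysis.
Import Order.TTheory GRing.Theory Num.Theory.
Import numFieldTopology.Exports numFieldNormedType.Exports.

Set Implicit Arguments.
Unset Strict Implicit.
Unset Printing Implicit Defensive.

Local Open Scope classical_set_scope.
Local Open Scope ring_scope.

(* Multiplicativity and [unorm_eq0] force [unorm 1 = 1]. *)
Record ultrametric_norm (R : realType) (K : fieldType) := UltrametricNorm {
  unorm :> K -> R;
  unorm_ge0 : forall x, 0 <= unorm x;
  unorm_eq0 : forall x, unorm x = 0 -> x = 0;
  unorm0 : unorm 0 = 0;
  unormM : forall x y, unorm (x * y) = unorm x * unorm y;
  unormD : forall x y, unorm (x + y) <= Num.max (unorm x) (unorm y)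
}.

Section NormTheory.
Context {R : realType} {K : fieldType}.
Implicit Type v : ultrametric_norm R K.

Definition nontrivial_norm v := exists2 x : K, x != 0 & v x != 1.

Definition complete_norm v := forall u : nat -> K,
  (forall e : R, 0 < e -> \forall m & n \near \oo, v (u m - u n) < e) ->
  exists l : K, v (u n - l) @[n --> \oo] --> (0 : R).

Lemma unorm1 v : v 1 = 1.
Proof.
have /eqP v1 : v 1 != 0.
  by apply/eqP => /unorm_eq0/eqP; rewrite oner_eq0.
by apply: (mulfI (introN eqP v1)); rewrite -unormM !mulr1.
Qed.

Lemma unormN v x : v (- x) = v x.
Proof.
have vN1 : v (-1) = 1.
  apply/eqP; rewrite -(@pexpr_eq1 _ _ 2) ?unorm_ge0//.
  by rewrite expr2 -unormM mulrNN mulr1 unorm1.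
by rewrite -mulN1r unormM vN1 mul1r.
Qed.

Definition unit_ball v : {pred K} := [pred x | v x <= 1].

Lemma unit_ball_subring v : subring_closed (unit_ball v).
Proof.
split=> [|x y|x y]; rewrite !inE ?unorm1// => vx vy.
  by rewrite (le_trans (unormD _ _ _))// unormN ge_max vx.
by rewrite unormM mulr_ile1 ?unorm_ge0.
Qed.

HB.instance Definition _ v :=
  GRing.isSubringClosed.Build K (unit_ball v) (unit_ball_subring v).

Definition valuation_ring v := {x : K | x \in unit_ball v}.

HB.instance Definition _ v := SubType.on (valuation_ring v).
HB.instance Definition _ v := Choice.on (valuation_ring v).
HB.instance Definition _ v :=
  [SubChoice_isSubComNzRing of valuation_ring v by <:].

Definition maximal_ideal v : {pred valuation_ring v} :=
  [pred x | v (val x) < 1].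

Lemma maximal_ideal_closed v : idealr_closed (@maximal_ideal v).
Proof.
split; rewrite ?inE /= ?unorm0 ?unorm1 ?ltxx// => a x y.
rewrite !inE => vx vy; rewrite rmorphD rmorphM/=.
rewrite (le_lt_trans (unormD _ _ _))// gt_max vy andbT unormM.
rewrite (le_lt_trans _ vx)// ler_piMl ?unorm_ge0//.
exact: (valP a).
Qed.

HB.instance Definition _ v := isIdealr.Build (valuation_ring v)
  (@maximal_ideal v) (@maximal_ideal_closed v).

(* Only the commutative ring structure of the quotient is used: it suffices to
   speak about the characteristic. *)
Definition residue_field v : comNzRingType := {ideal_quot (@maximal_ideal v)}.

End NormTheory.

(* The Berkovich affine line: multiplicative seminorms on K[X] that extend the
   norm of K, with the topology of pointwise convergence. *)
Record berk_line (R : realType) (K : fieldType) (v : ultrametric_norm R K) :=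
  BerkLine {
    seminorm :> {poly K} -> R;
    seminorm_ge0 : forall f, 0 <= seminorm f;
    seminormC : forall c, seminorm c%:P = v c;
    seminormM : forall f g, seminorm (f * g) = seminorm f * seminorm g;
    seminormD : forall f g, seminorm (f + g) <= seminorm f + seminorm g
  }.

Section BerkovichLine.
Context {R : realType} {K : fieldType} (v : ultrametric_norm R K).

HB.instance Definition _ := gen_eqMixin (berk_line v).
HB.instance Definition _ := gen_choiceMixin (berk_line v).
HB.instance Definition _ := Topological.copy (berk_line v)
  (initial_topology
     (fun x : berk_line v => (x : {poly K} -> R) : {ptws {poly K} -> R})).

(* The affine line is locally compact Hausdorff; the projective line is its
   one-point compactification, [None] being the point at infinity. *)
Definition berk_proj_line : topologicalType :=
  one_point_compactification (berk_line v).

Section Pushforward.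
Variables (P : {poly K}) (x : berk_line v).

Let pushf (f : {poly K}) : R := x (f \Po P).

Let pushf_ge0 f : 0 <= pushf f.
Proof. exact: seminorm_ge0. Qed.

Let pushfC c : pushf c%:P = v c.
Proof. by rewrite /pushf comp_polyC seminormC. Qed.

Let pushfM f g : pushf (f * g) = pushf f * pushf g.
Proof. by rewrite /pushf comp_polyM seminormM. Qed.

Let pushfD f g : pushf (f + g) <= pushf f + pushf g.
Proof. by rewrite /pushf comp_polyD seminormD. Qed.

Definition berk_push : berk_line v := BerkLine pushf_ge0 pushfC pushfM pushfD.

End Pushforward.

(* The action of P as a rational map; it is the intended one for nonconstant P
   only, since a constant rational map does not fix infinity. *)
Definition poly_act (P : {poly K}) (x : berk_proj_line) : berk_proj_line :=
  omap (berk_push P) x.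

Section Evaluation.
Variable z : K.

Let evalf (f : {poly K}) : R := v f.[z].

Let evalf_ge0 f : 0 <= evalf f.
Proof. exact: unorm_ge0. Qed.

Let evalfC c : evalf c%:P = v c.
Proof. by rewrite /evalf hornerC. Qed.

Let evalfM f g : evalf (f * g) = evalf f * evalf g.
Proof. by rewrite /evalf hornerM unormM. Qed.

Let evalfD f g : evalf (f + g) <= evalf f + evalf g.
Proof.
rewrite /evalf hornerD (le_trans (unormD _ _ _))// ge_max.
by rewrite lerDl lerDr !unorm_ge0.
Qed.

Definition berk_eval : berk_line v := BerkLine evalf_ge0 evalfC evalfM evalfD.

End Evaluation.

(* The classical projective line over K is [option K], with [None] as infinity. *)
Definition proj_point (z : option K) : berk_proj_line := omap berk_eval z.

Definition rational_disk_affine (D : set K) :=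
  exists z0 r, [/\ 0 < r, (exists2 c : K, c != 0 & r = v c) &
    D = [set z | v (z - z0) < r]].

Definition moebius (a b c d : K) (z : option K) : option K :=
  match z with
  | Some w => if c * w + d == 0 then None else Some ((a * w + b) / (c * w + d))
  | None => if c == 0 then None else Some (a / c)
  end.

Definition rational_disk (D : set (option K)) :=
  exists a b c d (E : set K), [/\ a * d - b * c != 0, rational_disk_affine E &
    D = moebius a b c d @` (Some @` E)].

Definition berk_rational_disk (U : set berk_proj_line) :=
  rational_disk (proj_point @^-1` U).

End BerkovichLine.

Section FatouComponents.
Context {T : topologicalType}.
Variable F : T -> T.

Definition fatou_set : set T := [set x | exists U, [/\ open U, U x &
  infinite_set (~` \bigcup_(n in [set: nat]) (iter n F @` U))]].

Definition fatou_component (U : set T) :=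
  exists2 x, fatou_set x & U = connected_component fatou_set x.

Definition wandering (U : set T) :=
  trivIset [set: nat] (fun i => iter i F @` U).

Definition asymptotic_to_periodic_orbit (x : T) :=
  exists (y : T) (p : nat), [/\ (0 < p)%N, iter p F y = y &
    forall j : nat, iter (n * p + j) F x @[n --> \oo] --> iter j F y].

Definition trivial_wandering (U : set T) :=
  exists2 x, U x & asymptotic_to_periodic_orbit x.

Definition nontrivial_wandering (U : set T) :=
  [/\ fatou_component U, wandering U & ~ trivial_wandering U].

End FatouComponents.

(* Main.v *)
(** Consider P_t(z) = z^p + b z + c z^q + t (z - beta), with coefficients such
    that beta is a repelling fixed point of every P_t. Near beta, P_t multiplies
    distances by a constant L > 1. On a disk |z| <= G that P_t maps onto
    |z| <= G^p = |beta|, it turns the distance h of two points into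
    max(h^p, |b| h): because of the wild ramification of z^p, small disks shrink
    by the constant factor |b| = L^-3. Hence a small disk may stay longer and
    longer alternately near beta and near 0, and recover its size each time.

    As K need not be spherically complete, a sequence of nested disks of points
    whose orbits follow the wanted itinerary might have an empty intersection.
    Instead we follow one point depending on t: the disks of parameters for which
    its orbit follows the first n steps of the itinerary have radii tending to 0,
    and completeness applies. The resulting disk wanders and is nontrivial because
    the itinerary is not eventually periodic. Every larger disk grows under
    iteration until it covers beta, so iterated preimages of beta accumulate at
    the boundary point of the disk in the Berkovich line; they lie in the Julia
    set, hence so does the boundary point, and the disk is a Fatou component. *)
Require Import Defs.
From mathcomp Require Import all_boot all_order all_algebra.
From mathcomp Require Import ring_quotient.
From mathcomp Require Import all_classical all_reals all_analysis.
From mathcomp Require Import ring lra zify.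
Import Order.TTheory GRing.Theory Num.Theory.
Import numFieldTopology.Exports numFieldNormedType.Exports.

Set Implicit Arguments.
Unset Strict Implicit.
Unset Printing Implicit Defensive.

Local Open Scope classical_set_scope.
Local Open Scope quotient_scope.
Local Open Scope ring_scope.

Lemma expr_unbounded (R : realType) (x e : R) : 1 < x -> exists n, e < x ^+ n.
Proof.
move=> x1; have bernoulli n : 1 + (x - 1) *+ n <= x ^+ n.
  elim: n => [|n IH]; first by rewrite mulr0n addr0 expr0.
  rewrite exprS mulrS; have : 0 <= (x - 1) *+ n by rewrite mulrn_wge0// subr_ge0 ltW.
  by move: IH x1; move: (_ *+ n) (x ^+ n) => A B; nra.
have [n ne] : exists n : nat, e / (x - 1) < n%:R.
  by exists (Num.truncn (`|e / (x - 1)|)).+1; rewrite (le_lt_trans (ler_norm _))// truncnS_gt.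
exists n; rewrite (lt_le_trans _ (bernoulli n))//.
by rewrite -mulr_natl ltr_wpDl// -ltr_pdivrMr// subr_gt0.
Qed.

(** * Ultrametric norms and polynomials *)

Section UltrametricNorm.
Context {R : realType} {K : fieldType} (v : ultrametric_norm R K).
Implicit Types (x y z : K) (e : R).

Lemma unorm_eq0E x : (v x == 0) = (x == 0).
Proof.
apply/eqP/eqP => [/unorm_eq0//|->]; exact: unorm0.
Qed.

Lemma unorm_gt0 x : (0 < v x) = (x != 0).
Proof. by rewrite lt_def unorm_ge0 andbT unorm_eq0E. Qed.

Lemma unormBC x y : v (x - y) = v (y - x).
Proof. by rewrite -unormN opprB. Qed.

Lemma unormX x n : v (x ^+ n) = v x ^+ n.
Proof.
by elim: n => [|n IH]; rewrite ?expr0 ?unorm1// !exprS unormM IH.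
Qed.

Lemma unormV x : v x^-1 = (v x)^-1.
Proof.
have [->|x0] := eqVneq x 0; first by rewrite invr0 unorm0 invr0.
have vx0 : v x != 0 by rewrite unorm_eq0E.
by apply: (mulfI vx0); rewrite -unormM !mulfV// unorm1.
Qed.

Lemma unormD_le x y e : v x <= e -> v y <= e -> v (x + y) <= e.
Proof. by move=> xe ye; rewrite (le_trans (unormD _ _ _))// ge_max xe. Qed.

Lemma unormD_lt x y e : v x < e -> v y < e -> v (x + y) < e.
Proof. by move=> xe ye; rewrite (le_lt_trans (unormD _ _ _))// gt_max xe. Qed.

Lemma unormB_le x y e : v x <= e -> v y <= e -> v (x - y) <= e.
Proof. by move=> xe ye; apply: unormD_le => //; rewrite unormN. Qed.

Lemma unormB_lt x y e : v x < e -> v y < e -> v (x - y) < e.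
Proof. by move=> xe ye; apply: unormD_lt => //; rewrite unormN. Qed.

Lemma unormDr x y : v y < v x -> v (x + y) = v x.
Proof.
move=> yx; apply/eqP; rewrite eq_le unormD_le ?(ltW yx)//=.
rewrite leNgt; apply/negP => xyx.
have : v (x + y - y) < v x by apply: unormB_lt.
by rewrite addrK ltxx.
Qed.

Lemma unormDl x y : v x < v y -> v (x + y) = v y.
Proof. by move=> xy; rewrite addrC unormDr. Qed.

Lemma unormBr x y : v y < v x -> v (x - y) = v x.
Proof. by move=> yx; rewrite unormDr// unormN. Qed.

Lemma unormBl x y : v x < v y -> v (x - y) = v y.
Proof. by move=> xy; rewrite unormBC unormBr. Qed.

Lemma unorm_close x y : v (x - y) < v y -> v x = v y.
Proof. by move=> xy; rewrite -[x](subrK y) unormDl. Qed.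

Lemma unorm_triangle x y z e : v (x - y) <= e -> v (y - z) <= e -> v (x - z) <= e.
Proof. by move=> xy yz; rewrite -(subrKA y) unormD_le. Qed.

Lemma unorm_triangle_lt x y z e : v (x - y) < e -> v (y - z) < e -> v (x - z) < e.
Proof. by move=> xy yz; rewrite -(subrKA y) unormD_lt. Qed.

Lemma unorm_nat n : v n%:R <= 1.
Proof.
by elim: n => [|n IH]; rewrite ?unorm0// -natr1 unormD_le// unorm1.
Qed.

Lemma unormMn_le x n : v (x *+ n) <= v x.
Proof.
by rewrite -mulr_natr unormM ler_piMr ?unorm_ge0 ?unorm_nat.
Qed.

Lemma unorm_sum_le (I : Type) (s : seq I) (P : pred I) (F : I -> K) e :
  0 <= e -> (forall i, P i -> v (F i) <= e) ->
  v (\sum_(i <- s | P i) F i) <= e.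
Proof.
move=> e0 Fe; elim/big_ind: _ => //; first by rewrite unorm0.
by move=> x y; exact: unormD_le.
Qed.

(** Mean value estimate |x^n - y^n| <= |x - y| e^(n-1); the extra factor [e] on both sides avoids
    the exponent n - 1 and a division. *)
Lemma unormX_sub_le x y e n : v x <= e -> v y <= e ->
  v (x ^+ n - y ^+ n) * e <= v (x - y) * e ^+ n.
Proof.
move=> xe ye; have e0 : 0 <= e := le_trans (unorm_ge0 _ _) xe.
elim: n => [|n IH].
  by rewrite subrr unorm0 mul0r mulr_ge0// unorm_ge0.
have -> : x ^+ n.+1 - y ^+ n.+1 = x * (x ^+ n - y ^+ n) + (x - y) * y ^+ n.
  by rewrite !exprS; ring.
rewrite (le_trans (ler_wpM2r e0 (unormD _ _ _)))// maxr_pMl// ge_max.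
rewrite !unormM unormX -!mulrA.
apply/andP; split.
  rewrite (exprS e) [leRHS]mulrCA.
  by rewrite ler_pM// ?mulr_ge0 ?unorm_ge0.
rewrite exprSr ler_wpM2l ?unorm_ge0// ler_wpM2r// lerXn2r// nnegrE//.
exact: unorm_ge0.
Qed.

(** Second-order Taylor remainder of z^(n+1) at [y]: its quotient by (x - y)^2 is an integral form
    of degree n - 1. *)
Lemma unormX_sub2_le x y e n : v x <= e -> v y <= e ->
  v (x ^+ n.+1 - y ^+ n.+1 - (x - y) * y ^+ n *+ n.+1) * e
    <= v (x - y) ^+ 2 * e ^+ n.
Proof.
move=> xe ye; have e0 : 0 <= e := le_trans (unorm_ge0 _ _) xe.
elim: n => [|n IH].
  rewrite !expr1 expr0 mulr1 mulr1n subrr unorm0 mul0r.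
  by rewrite mulr_ge0// exprn_ge0// unorm_ge0.
have -> : x ^+ n.+2 - y ^+ n.+2 - (x - y) * y ^+ n.+1 *+ n.+2 =
    x * (x ^+ n.+1 - y ^+ n.+1 - (x - y) * y ^+ n *+ n.+1)
    + (x - y) ^+ 2 * y ^+ n *+ n.+1.
  rewrite (exprS x n.+1) (exprS y n.+1) (mulrSr _ n.+1).
  rewrite -(mulr_natr (_ * y ^+ n) n.+1) -(mulr_natr (_ * y ^+ n.+1) n.+1).
  rewrite -(mulr_natr (_ ^+ 2 * _) n.+1).
  move: (x ^+ n.+1) (n.+1%:R : K) => X m; rewrite (exprS y n).
  by move: (y ^+ n) => Y; ring.
rewrite (le_trans (ler_wpM2r e0 (unormD _ _ _)))// maxr_pMl// ge_max.
apply/andP; split.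
  rewrite unormM -mulrA (exprS e) [leRHS]mulrCA.
  by rewrite ler_pM// ?mulr_ge0 ?unorm_ge0.
rewrite (exprSr e) mulrA ler_wpM2r// (le_trans (unormMn_le _ _))//.
rewrite unormM !unormX ler_wpM2l ?exprn_ge0 ?unorm_ge0//.
by rewrite lerXn2r// nnegrE unorm_ge0.
Qed.

End UltrametricNorm.

Section PolyIter.
Context {K : idomainType}.
Implicit Types (P : {poly K}) (z : K).

Fixpoint poly_iter P n : {poly K} :=
  if n is n'.+1 then P \Po poly_iter P n' else 'X.

Lemma horner_poly_iter P n z : (poly_iter P n).[z] = iter n (horner P) z.
Proof. by elim: n => [|n IH]; rewrite /= ?hornerX// horner_comp IH. Qed.

Lemma size_poly_iter P n : (1 < size P)%N -> (1 < size (poly_iter P n))%N.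
Proof.
move=> P1; elim: n => [|n IH] /=; first by rewrite size_polyX.
have : (0 < (size (P \Po poly_iter P n)).-1)%N.
  by rewrite size_comp_poly muln_gt0 -2!subn1 2!subn_gt0 P1.
by case: (size _) => [|[]].
Qed.

End PolyIter.

(** * Roots, covering of disks and the value group over an algebraically closed field *)

Section AlgebraicallyClosed.
Context {R : realType} {K : closedFieldType} (v : ultrametric_norm R K).
Implicit Types (x y z : K) (Q : {poly K}).

Lemma nth_root z n : (0 < n)%N -> exists y, y ^+ n = z.
Proof.
move=> n0; have [|y] := @closed_rootP K ('X^n - z%:P) _.
  by rewrite size_XnsubC//; case: n n0.
by rewrite rootE !hornerE subr_eq0 => /eqP; exists y.
Qed.

(** Each factor changes by less than its absolute value, so its norm is the same at [x] and [y], and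
    this relative bound passes to products. *)
Lemma prod_factor_sub_lt (s : seq K) x y :
  (forall z, z \in s -> v (y - x) < v (z - x)) ->
  v (\prod_(z <- s) (y - z) - \prod_(z <- s) (x - z))
    < v (\prod_(z <- s) (x - z)).
Proof.
elim: s => [|z s IH] h; first by rewrite !big_nil subrr unorm0 unorm1.
have zyx : v (y - x) < v (x - z) by rewrite [ltRHS]unormBC h// mem_head.
have {IH}lts := IH (fun w ws => h w (mem_behead (s := z :: s) ws)).
rewrite !big_cons.
have -> a b : (y - z) * a - (x - z) * b = (y - z) * (a - b) + (y - x) * b.
  ring.
have yz : v (y - z) = v (x - z).
  by apply: unorm_close; rewrite opprB addrA subrK.
have b0 : 0 < v (\prod_(z0 <- s) (x - z0)) by rewrite (le_lt_trans _ lts)// unorm_ge0.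
rewrite !unormM unormD_lt// unormM.
- by rewrite yz ltr_pM2l// (le_lt_trans _ zyx)// unorm_ge0.
- by rewrite ltr_pM2r.
Qed.

(* A nonarchimedean intermediate value theorem: if [Q - y] had no root in the
   closed disk of center [x] through [z], then each factor of [Q - y] would vary
   by less than its absolute value at [x]. *)
Lemma poly_covering Q x z y : v (Q.[x] - y) <= v (Q.[z] - Q.[x]) ->
  exists2 t, Q.[t] = y & v (t - x) <= v (z - x).
Proof.
move=> h; have [Qx|Qx] := eqVneq Q.[x] y.
  by exists x => //; rewrite subrr unorm0 unorm_ge0.
apply: contrapT => hn.
have [s Es] := closed_field_poly_normal (Q - y%:P).
set l := lead_coef _ in Es.
have hE w : Q.[w] - y = l * \prod_(i <- s) (w - i).
  have := congr1 (horner^~ w) Es.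
  rewrite !hornerE horner_prod => ->; congr (_ * _).
  by apply: eq_bigr => i _; rewrite !hornerE.
have l0 : l != 0.
  by apply: contra_neq Qx => l0; apply/eqP; rewrite -subr_eq0 hE l0 mul0r.
have : forall i, i \in s -> v (z - x) < v (i - x).
  move=> i si; rewrite ltNge; apply/negP => le_i; apply: hn; exists i => //.
  apply/eqP; rewrite -subr_eq0 hE mulf_eq0 (negPf l0)/=.
  by rewrite prodf_seq_eq0; apply/hasP; exists i => //=; rewrite subrr.
move=> /prod_factor_sub_lt; apply/negP; rewrite -leNgt.
have l_gt0 : 0 < v l by rewrite unorm_gt0.
rewrite -(ler_pM2l l_gt0) -!unormM mulrBr -!hE.
by rewrite opprB addrA subrK.
Qed.

(** If all roots of [Q - y] were farther than [e] from [x], the factorization would give |Q(x) - y|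
    >= |lead Q| e^(deg Q); this lower bound is the radius [d]. *)
Lemma poly_open_map Q x e : (1 < size Q)%N -> 0 < e -> exists2 d, 0 < d &
  forall y, v (Q.[x] - y) < d -> exists2 t, Q.[t] = y & v (t - x) <= e.
Proof.
move=> sQ e0.
have l0 : lead_coef Q != 0 by rewrite lead_coef_eq0 -size_poly_gt0 ltnW.
exists (v (lead_coef Q) * e ^+ (size Q).-1).
  by rewrite mulr_gt0 ?unorm_gt0// exprn_gt0.
move=> y; have [s Es] := closed_field_poly_normal (Q - y%:P).
have lE : lead_coef (Q - y%:P) = lead_coef Q.
  by rewrite lead_coefDl// size_polyN (leq_ltn_trans (size_polyC_leq1 _)).
rewrite lE in Es.
have hE w : Q.[w] - y = lead_coef Q * \prod_(i <- s) (w - i).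
  have := congr1 (horner^~ w) Es.
  rewrite !hornerE horner_prod => ->; congr (_ * _).
  by apply: eq_bigr => i _; rewrite !hornerE.
have sE : (size Q).-1 = size s.
  rewrite -(@size_polyDl _ Q (- y%:P)) ?Es ?size_scale// ?size_prod_XsubC//.
  by rewrite size_polyN (leq_ltn_trans (size_polyC_leq1 _)).
rewrite hE unormM ltr_pM2l ?unorm_gt0// sE => lt_s.
apply: contrapT => hn; move: lt_s; apply/negP; rewrite -leNgt.
have : forall i, i \in s -> e <= v (x - i).
  move=> i si; rewrite leNgt; apply/negP => lt_i; apply: hn; exists i.
    apply/eqP; rewrite -subr_eq0 hE mulf_eq0 (negPf l0)/=.
    by rewrite prodf_seq_eq0; apply/hasP; exists i => //=; rewrite subrr.
  by rewrite unormBC ltW.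
elim: s {Es hE sE hn} => [|i s IH] h; first by rewrite big_nil unorm1.
rewrite big_cons unormM exprS ler_pM ?exprn_ge0 ?h ?mem_head//; try exact: ltW.
by apply: IH => j js; apply: h; rewrite in_cons js orbT.
Qed.

(* The value group is divisible, hence dense. *)
Lemma unorm_dense (a b : R) : nontrivial_norm v -> 0 <= a -> a < b ->
  exists x, a < v x < b.
Proof.
move=> [x0 x00 vx0] a0 ab.
have [x x1] : exists x, 1 < v x.
  have [|x01] := ltP 1 (v x0); first by exists x0.
  exists x0^-1; rewrite unormV invf_gt1 ?unorm_gt0//.
  by rewrite lt_neqAle vx0.
pose a' := Num.max a (b / 2); have b0 : 0 < b := le_lt_trans a0 ab.
have a'0 : 0 < a' by rewrite lt_max divr_gt0// orbT.
have a'b : a' < b by rewrite gt_max ab ltr_pdivrMr// ltr_pMr// ltr1n.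
have [n xn] : exists n, v x < (b / a') ^+ n.
  by apply: expr_unbounded; rewrite ltr_pdivlMr// mul1r.
have n0 : (0 < n)%N.
  by case: n xn => //; rewrite expr0 => /(lt_trans x1); rewrite ltxx.
(* An n-th root of [x] has norm between 1 and b / a', so the norms of its powers are spaced closely
   enough to hit the interval from a' to b. *)
have [y yn] := nth_root x n0; move: x1 xn; rewrite -yn unormX => y1 yb.
have {y1}y1 : 1 < v y by move: y1; rewrite expr_gt1// unorm_ge0.
have {yb} : v y < b / a'.
  by move: yb; rewrite ltr_pXn2r// nnegrE ?unorm_ge0// divr_ge0// ltW.
rewrite ltr_pdivlMr// => yb.
have y_gt0 : 0 < v y by rewrite (lt_trans _ y1).
(* The shift by |y|^N > 1/a' keeps the exponents natural; the least k with |y|^k > a' |y|^N yields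
   the element y^(k-N). *)
have [N aN] : exists N, a'^-1 < v y ^+ N by exact: expr_unbounded.
have [M aM] : exists k, a' * v y ^+ N < v y ^+ k by exact: expr_unbounded.
have ex : exists k, a' * v y ^+ N < v y ^+ k by exists M.
case: (ex_minnP ex) => -[|k] ak mink.
  move: ak; rewrite expr0 => /lt_trans/(_ _); have : 1 < a' * v y ^+ N.
    by rewrite mulrC -ltr_pdivrMr// mul1r.
  by move=> h /(_ _ h); rewrite ltxx.
exists (y ^+ k.+1 / y ^+ N); rewrite unormM unormV !unormX.
rewrite ltr_pdivlMr ?exprn_gt0// ltr_pdivrMr ?exprn_gt0//.
rewrite (le_lt_trans _ (ak : _ < _)) ?ler_wpM2r ?exprn_ge0 ?(ltW y_gt0) ?le_max ?lexx//=.
have : v y ^+ k <= a' * v y ^+ N.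
  by rewrite leNgt; apply/negP => /mink; rewrite ltnn.
rewrite -(ler_pM2l y_gt0) -exprS => /le_lt_trans; apply.
by rewrite mulrA ltr_pM2r ?exprn_gt0.
Qed.

End AlgebraicallyClosed.

(** * A family of polynomials with a wandering disk *)

Section Family.
Context {R : realType} {K : closedFieldType} (v : ultrametric_norm R K).
Variables (k : nat) (g beta lincoef topcoef : K).
Implicit Types (t z w : K).

Let p := k.+1.
(* Large enough for [c z^q] to be negligible against [b z] on [|z| <= G], and
   prime to [p] so that the multiplier of [beta] comes from this term. *)
Let q := (5 * p).+1.

Definition family t : {poly K} :=
  'X^p + lincoef *: 'X + topcoef *: 'X^q + t *: ('X - beta%:P).

Let G : R := v g.
Let r : R := v beta.
Let L : R := r ^+ k.

Lemma familyE t z : (family t).[z] =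
  z ^+ p + lincoef * z + topcoef * z ^+ q + t * (z - beta).
Proof. by rewrite /family !hornerE. Qed.

Hypothesis rE : r = G ^+ p.
Hypothesis vb : v lincoef = (L ^+ 3)^-1.
Hypothesis cE : topcoef * beta ^+ q = beta - beta ^+ p - lincoef * beta.
Hypothesis p_prime : prime p.
Hypothesis G_gt1 : 1 < G.
(* Makes the middle terms of [(z + w)^p] negligible against [b w]. *)
Hypothesis vp : v p%:R * L ^+ 4 < 1.

Let k_gt0 : (0 < k)%N. Proof. by have := prime_gt1 p_prime; rewrite ltnS. Qed.
Let G_gt0 : 0 < G. Proof. exact: lt_trans G_gt1. Qed.
Let G_ge0 : 0 <= G. Proof. exact: ltW. Qed.
Let r_gt1 : 1 < r. Proof. by rewrite rE exprn_egt1. Qed.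
Let r_gt0 : 0 < r. Proof. exact: lt_trans r_gt1. Qed.
Let r_ge0 : 0 <= r. Proof. exact: ltW. Qed.
Let G_lt_r : G < r.
Proof. by rewrite rE -[ltLHS]expr1 ltr_eXn2l// prime_gt1. Qed.
Let L_gt1 : 1 < L. Proof. by rewrite exprn_egt1// -lt0n. Qed.
Let L_gt0 : 0 < L. Proof. exact: lt_trans L_gt1. Qed.
Let L_ge0 : 0 <= L. Proof. exact: ltW. Qed.
Let r_le_L : r <= L.
Proof. by rewrite -[leLHS]expr1 ler_eXn2l. Qed.
Let beta0 : beta != 0. Proof. by rewrite -(unorm_gt0 v). Qed.
Let vb_gt0 : 0 < v lincoef. Proof. by rewrite vb invr_gt0 exprn_gt0. Qed.
Let vb_lt1 : v lincoef < 1.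
Proof. by rewrite vb invf_lt1 ?exprn_gt0// exprn_egt1. Qed.

(** In the fixed point equation [cE] the term beta^p dominates, so |c| r^q = r^p, and q - p = 4k +
    5. *)
Let vc : v topcoef * r ^+ (4 * k + 5) = 1.
Proof.
have -> : v topcoef = r ^+ p / r ^+ q.
  apply: (canRL (mulfK _)); first by rewrite expf_neq0// gt_eqF.
  rewrite -unormX -unormM cE.
  have rp : r < r ^+ p by rewrite -[ltLHS]expr1 ltr_eXn2l// prime_gt1.
  have b1 : v (beta - beta ^+ p) = r ^+ p.
    by rewrite unormBl unormX.
  by rewrite unormBr b1// unormM -/r (lt_trans _ rp)// gtr_pMl.
have -> : q = (p + (4 * k + 5))%N by rewrite /q /p; clear; lia.
by rewrite exprD invfM mulrA mulfV ?mul1r ?mulVf// expf_neq0// gt_eqF.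
Qed.

Let vc_gt0 : 0 < v topcoef.
Proof.
rewrite unorm_gt0; apply/eqP => c0; move: vc; rewrite c0 unorm0 mul0r.
by move/esym/eqP; rewrite oner_eq0.
Qed.

Lemma family_beta t : (family t).[beta] = beta.
Proof.
rewrite familyE subrr mulr0 addr0 cE.
by move: (beta ^+ p) (lincoef * beta) => x y; ring.
Qed.

(** The prime p divides the middle binomial coefficients, and each middle monomial contains a factor
    [w]. *)
Lemma frobenius_sub_le z w : v z <= G -> v w <= G ->
  v ((z + w) ^+ p - z ^+ p - w ^+ p) <= v p%:R * G ^+ k * v w.
Proof.
move=> zG wG; rewrite exprDn big_ord_recl big_ord_recr/=.
rewrite subn0 /bump /= add1n subnn !expr0 mulr1 mul1r bin0 -/p binn !mulr1n.
set S := \sum_(_ < _) _. 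
rewrite addrAC addrA addrK addrAC subrr add0r {}/S.
apply: unorm_sum_le => [|[i ik] _ /=]; first by rewrite !mulr_ge0 ?exprn_ge0 ?unorm_ge0.
rewrite /bump /= add1n.
have /dvdnP[m ->] : (p %| 'C(p, i.+1))%N by rewrite prime_dvd_bin//= ltnS.
rewrite -[_ *+ (m * _)]mulr_natl natrM !unormM !unormX -[leRHS]mulrA.
have zw : v z ^+ (p - i.+1) * v w ^+ i.+1 <= G ^+ k * v w.
  rewrite subSS exprSr mulrA ler_wpM2r ?unorm_ge0//.
  rewrite -[in leRHS](subnK (ltnW ik)) exprD.
  by rewrite ler_pM ?exprn_ge0 ?unorm_ge0// lerXn2r// nnegrE ?unorm_ge0.
apply: ler_pM => //; rewrite ?mulr_ge0 ?exprn_ge0 ?unorm_ge0//.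
by rewrite ler_piMl ?unorm_ge0// unorm_nat.
Qed.

(** The errors come from the middle binomial terms, from c z^q and from the perturbation; each is
    dominated by the linear term. *)
Lemma family_sub_near0 t z w : v z <= G -> v w <= G -> v t < v lincoef ->
  z != w ->
  v ((family t).[z] - (family t).[w] - ((z - w) ^+ p + lincoef * (z - w)))
    < v lincoef * v (z - w).
Proof.
move=> zG wG tb zw; rewrite !familyE.
have h0 : 0 < v (z - w) by rewrite unorm_gt0 subr_eq0.
have hG : v (z - w) <= G by apply: unormB_le.
have -> : z ^+ p + lincoef * z + topcoef * z ^+ q + t * (z - beta)
  - (w ^+ p + lincoef * w + topcoef * w ^+ q + t * (w - beta))
  - ((z - w) ^+ p + lincoef * (z - w)) =
  (z ^+ p - w ^+ p - (z - w) ^+ p) + topcoef * (z ^+ q - w ^+ q) + t * (z - w).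
  by move: (z ^+ p) (w ^+ p) (z ^+ q) (w ^+ q) ((z - w) ^+ p) => *; ring.
apply: unormD_lt; first apply: unormD_lt.
(* Here G^k <= L, so |p| G^k < L^-3 = |b| follows from [vp]. *)
- have := frobenius_sub_le wG hG; rewrite [w + _]addrC subrK => /le_lt_trans; apply.
  rewrite ltr_pM2r// vb -[ltRHS]mul1r ltr_pdivlMr ?exprn_gt0//.
  rewrite -mulrA (le_lt_trans _ vp)// ler_wpM2l ?unorm_ge0// [leRHS]exprS.
  by rewrite ler_pM2r ?exprn_gt0// lerXn2r ?nnegrE// ltW.
(* By G^(5p) = r^5 the factor is at most |c| r^5 = r^(-4k), which is below |b| = r^(-3k). *)
- rewrite unormM.
  have := unormX_sub_le q zG wG.
  rewrite (exprSr G) mulrA ler_pM2r// (mulnC 5) exprM -rE => le1.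
  rewrite (le_lt_trans (ler_wpM2l (unorm_ge0 _ _) le1))//.
  rewrite mulrCA mulrC ltr_pM2r// vb -[ltRHS]mul1r ltr_pdivlMr ?exprn_gt0//.
  rewrite -mulrA -vc ltr_pM2l//.
  rewrite /L -exprM -exprD ltr_eXn2l//; clear -k_gt0; lia.
- by rewrite unormM ltr_pM2r.
Qed.

Lemma family_sub_near0_le t z w : v z <= G -> v w <= G -> v t < v lincoef ->
  v ((family t).[z] - (family t).[w])
    <= Num.max (v (z - w) ^+ p) (v lincoef * v (z - w)).
Proof.
move=> zG wG tb; have [->|zw] := eqVneq z w.
  by rewrite !subrr unorm0 mulr0 le_max lexx orbT.
rewrite -[X in v X](subrK ((z - w) ^+ p + lincoef * (z - w))).
rewrite unormD_le//.
  by rewrite le_max (ltW (family_sub_near0 _ _ _ _))// orbT.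
by rewrite (le_trans (unormD _ _ _))// unormX unormM.
Qed.

(** The terms h^p and |b| h balance at the distance h = r^-3; above it the power dominates, below it
    the linear term. *)
Lemma family_sub_near0_expr t z w : v z <= G -> v w <= G -> v t < v lincoef ->
  v lincoef < v (z - w) ^+ k ->
  v ((family t).[z] - (family t).[w]) = v (z - w) ^+ p.
Proof.
move=> zG wG tb bh; have zw : z != w.
  apply: contraTneq bh => ->; rewrite subrr unorm0 expr0n eqn0Ngt k_gt0/=.
  by rewrite -leNgt unorm_ge0.
have h0 : 0 < v (z - w) by rewrite unorm_gt0 subr_eq0.
have bhp : v lincoef * v (z - w) < v (z - w) ^+ p by rewrite exprSr ltr_pM2r.
have hE : v ((z - w) ^+ p + lincoef * (z - w)) = v (z - w) ^+ p.
  by rewrite unormDr ?unormX// unormM.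
rewrite -[RHS]hE; apply: unorm_close; rewrite hE.
exact: lt_trans (family_sub_near0 _ _ _ _) bhp.
Qed.

Lemma family_sub_near0_lin t z w : v z <= G -> v w <= G -> v t < v lincoef ->
  v (z - w) ^+ k < v lincoef ->
  v ((family t).[z] - (family t).[w]) = v lincoef * v (z - w).
Proof.
move=> zG wG tb bh; have [->|zw] := eqVneq z w.
  by rewrite !subrr unorm0 mulr0.
have h0 : 0 < v (z - w) by rewrite unorm_gt0 subr_eq0.
have bhp : v (z - w) ^+ p < v lincoef * v (z - w) by rewrite exprSr ltr_pM2r.
have hE : v ((z - w) ^+ p + lincoef * (z - w)) = v lincoef * v (z - w).
  by rewrite unormDl ?unormM// unormX.
by rewrite -[RHS]hE; apply: unorm_close; rewrite hE family_sub_near0.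
Qed.

Lemma family_near0_le t z s : v z <= G -> v t * r < v lincoef ->
  v z <= s -> 1 <= s -> v (family t).[z] <= s ^+ p.
Proof.
move=> zG tr zs s1.
have tb : v t < v lincoef.
  by rewrite (le_lt_trans _ tr)// ler_peMr ?unorm_ge0// ltW.
have f0 : v (family t).[0] <= s ^+ p.
  rewrite familyE !expr0n/= !mulr0 !add0r unormM unormN -/r.
  by rewrite (le_trans (ltW tr))// (le_trans (ltW vb_lt1))// exprn_ege1.
rewrite -[X in v X](subrK (family t).[0]) unormD_le//.
have G0 : v 0 <= G by rewrite unorm0.
rewrite (le_trans (family_sub_near0_le zG G0 tb))// subr0 ge_max.
have s0 : 0 <= s by rewrite (le_trans _ s1).
rewrite lerXn2r ?nnegrE ?unorm_ge0//= (le_trans (_ : _ <= s))//.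
  by rewrite (le_trans _ zs)// ler_piMl ?unorm_ge0// ltW.
by rewrite -[leLHS]expr1 ler_weXn2l.
Qed.

(** The power z^p dominates strictly on this annulus: |c z^(q-p)| reaches 1 only at |z| = r. *)
Lemma family_mid t z : v t * r < v lincoef -> 1 < v z < r ->
  v (family t).[z] = v z ^+ p.
Proof.
move=> t_small /andP[z1 zr]; have z0 : 0 < v z by exact: lt_trans z1.
have zp : v z < v z ^+ p by rewrite -[ltLHS]expr1 ltr_eXn2l// prime_gt1.
rewrite familyE -unormX -!addrA unormDr// unormX.
apply: unormD_lt; last apply: unormD_lt.
- by rewrite unormM (lt_trans _ zp)// gtr_pMl.
- have -> : v (topcoef * z ^+ q) = v topcoef * v z ^+ (4 * k + 5) * v z ^+ p.
    by rewrite unormM unormX -mulrA -exprD /q /p; congr (_ * _ ^+ _); clear; lia.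
  rewrite gtr_pMl ?exprn_gt0// -vc ltr_pM2l//.
  by rewrite ltrXn2r ?unorm_ge0// addnS.
- rewrite unormM unormBl// (lt_trans t_small)// (lt_trans vb_lt1)//.
  by rewrite exprn_egt1.
Qed.

Let vp_lt1 : v p%:R < 1.
Proof.
by rewrite (le_lt_trans _ vp)// ler_peMr ?unorm_ge0// exprn_ege1// ltW.
Qed.

Lemma family_sub_near_beta t z w : v (z - beta) < r -> v (w - beta) < r ->
  v t < 1 -> v ((family t).[z] - (family t).[w]) = L * v (z - w).
Proof.
move=> zb wb t1; have [->|zw] := eqVneq z w.
  by rewrite !subrr unorm0 mulr0.
have h0 : 0 < v (z - w) by rewrite unorm_gt0 subr_eq0.
have zr : v z = r by apply: unorm_close.
have wr : v w = r by apply: unorm_close.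
have hr : v (z - w) < r by apply: unorm_triangle_lt zb _; rewrite unormBC.
(* This uses q = 5p + 1 and |p| < 1. *)
have vq : v q%:R = 1.
  rewrite /q -natr1 natrM unormDl ?unorm1// unormM.
  by rewrite (le_lt_trans _ vp_lt1)// ler_piMl ?unorm_ge0// unorm_nat.
(* The derivative term of c z^q at [w], of norm |c| r^(5p) |z - w| = L |z - w|; everything else is
   strictly smaller. *)
pose main := topcoef * ((z - w) * w ^+ (5 * p) *+ q).
have mainE : v main = L * v (z - w).
  rewrite /main -mulr_natr !unormM unormX vq mulr1 wr mulrCA mulrC.
  have -> : (5 * p = 4 * k + 5 + k)%N by rewrite /p; (clear; lia).
  by rewrite exprD mulrA vc mul1r.
rewrite -mainE; apply: unorm_close; rewrite mainE !familyE.
have -> : z ^+ p + lincoef * z + topcoef * z ^+ q + t * (z - beta)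
  - (w ^+ p + lincoef * w + topcoef * w ^+ q + t * (w - beta)) - main =
  topcoef * (z ^+ q - w ^+ q - (z - w) * w ^+ (5 * p) *+ q) +
  ((z ^+ p - w ^+ p - (z - w) * w ^+ k *+ p) + (z - w) * w ^+ k *+ p) +
  lincoef * (z - w) + t * (z - w).
  rewrite /main; move: (z ^+ p) (w ^+ p) (z ^+ q) (w ^+ q) (_ *+ q) (_ *+ p).
  by move=> *; ring.
have hLr n : (v (z - w) ^+ 2 * r ^+ n < v (z - w) * r ^+ n * r).
  by rewrite [ltRHS]mulrAC ltr_pM2r ?exprn_gt0// expr2 ltr_pM2l.
have zr' : v z <= r by rewrite zr.
have wr' : v w <= r by rewrite wr.
apply: unormD_lt; first (apply: unormD_lt; first (apply: unormD_lt; last apply: unormD_lt)).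
- rewrite unormM -(ltr_pM2r r_gt0) -mulrA.
  apply: le_lt_trans (ler_wpM2l (unorm_ge0 _ _) (unormX_sub2_le (5 * p) zr' wr')) _.
  rewrite -[in ltRHS](mul1r L) -vc -!mulrA ltr_pM2l// !mulrA -[r ^+ _ * L]exprD.
  have -> : (5 * p = 4 * k + 5 + k)%N by rewrite /p; (clear; lia).
  by rewrite [r ^+ _ * v _]mulrC.
- rewrite -(ltr_pM2r r_gt0).
  apply: le_lt_trans (unormX_sub2_le k zr' wr') _.
  by rewrite [L * _]mulrC.
- rewrite -mulr_natr !unormM unormX wr -/L [v (z - w) * L]mulrC.
  by rewrite gtr_pMr// mulr_gt0.
- by rewrite unormM ltr_pM2r// (lt_trans vb_lt1).
- by rewrite unormM ltr_pM2r// (lt_trans t1).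
Qed.

(** Beyond r the term c z^q dominates z^p, which already has norm greater than r |z|. *)
Lemma family_escape t z : v t < 1 -> r < v z -> r * v z < v (family t).[z].
Proof.
move=> t1 rz; rewrite familyE.
have z_gt1 : 1 < v z by rewrite (lt_trans _ rz).
have z_gt0 : 0 < v z by rewrite (lt_trans _ z_gt1).
have rzp : r * v z < v z ^+ p.
  rewrite (@lt_le_trans _ _ (v z ^+ 2))// ?expr2 ?ltr_pM2r//.
  by rewrite -expr2 ler_weXn2l ?(ltW z_gt1)// prime_gt1.
have zzp : v z < v z ^+ p.
  by rewrite (lt_trans _ rzp)// ltr_pMl.
have cz : v (topcoef * z ^+ q) = v topcoef * v z ^+ (4 * k + 5) * v z ^+ p.
  by rewrite unormM unormX -mulrA -exprD /q /p; congr (_ * _ ^+ _); (clear; lia).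
have zcz : v z ^+ p < v (topcoef * z ^+ q).
  rewrite cz ltr_pMl ?exprn_gt0// -vc ltr_pM2l//.
  by rewrite ltrXn2r//; (clear; lia).
have h1 : v (z ^+ p + lincoef * z) < v (topcoef * z ^+ q).
  rewrite unormD_lt ?unormX// (lt_trans _ zcz)// unormM (lt_trans _ zzp)//.
  by rewrite gtr_pMl.
have h2 : v (z ^+ p + lincoef * z + topcoef * z ^+ q) = v (topcoef * z ^+ q).
  by rewrite unormDl.
rewrite unormDr h2; first exact: lt_trans zcz.
rewrite (lt_trans _ zcz)// (lt_trans _ zzp)// unormM.
by rewrite unormBr// gtr_pMl.
Qed.

(** * Construction of the parameter by following one orbit as a function of t *)

Lemma family_param t t' w :
  (family t).[w] - (family t').[w] = (t - t') * (w - beta).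
Proof.
rewrite !familyE; move: (w ^+ p) (w ^+ q) (lincoef * w) => *; ring.
Qed.

(** The orbit of the point beta (1 + t) under P_t, as polynomials in t, so that covering arguments
    apply to parameters. At t = 0 it is the fixed point beta. *)
Fixpoint orbit_poly n : {poly K} :=
  if n is n'.+1 then
    orbit_poly n' ^+ p + lincoef *: orbit_poly n' + topcoef *: orbit_poly n' ^+ q
      + 'X * (orbit_poly n' - beta%:P)
  else beta *: ('X + 1).

Let orb n t := (orbit_poly n).[t].

Lemma orbit_polyS n t :
  (orbit_poly n.+1).[t] = (family t).[(orbit_poly n).[t]].
Proof. by rewrite familyE /= !hornerE. Qed.

Let orbS n t : orb n.+1 t = (family t).[orb n t].
Proof. exact: orbit_polyS. Qed.

(* From time [block_start i] on, the orbit stays [repel_time i] steps near [beta]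
   and then [contract_time i] steps near 0. The relation
   [repel_time i.+1 = 3 * contract_time i - 1] is dictated by the disk of radius
   [r^-2] around the point where a stay near 0 begins: its radius is [r^-(2p)]
   after one step, then it is multiplied by [L^-3] at each further step near 0
   and by [L] at each step near [beta], and [r^-(2p) L^2 = r^-2]. *)
Definition repel_time i := (6 * i + 5)%N.
Definition contract_time i := (2 * i + 4)%N.
Definition block_start i := (4 * i * i + 5 * i)%N.

Let m_ := repel_time.
Let M_ := contract_time.
Let n_ := block_start.

Lemma block_startS i :
  block_start i.+1 = (block_start i + repel_time i + contract_time i)%N.
Proof. rewrite /block_start /repel_time /contract_time; (clear; lia). Qed.

(** Orbits that differ by r |t - t'| at the start of block i reach distance at most r after its
    expansion by L^(m_i). *)
Let D i t t' := v (t' - t) <= (L ^+ m_ i)^-1.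

(* By the end of a stay near 0, the differences between orbits accumulated
   before have been contracted away, and only the contribution of the last
   perturbation [t (z - beta)], of size [r |t|], remains. *)
Let state i t := [/\ orb (n_ i) t = beta, v t <= (L ^+ 5)^-1 &
  forall t' t'', D i t t' -> D i t t'' ->
    v (orb (n_ i) t' - orb (n_ i) t'') = r * v (t' - t'')].

Let DC i t : D i t t.
Proof. by rewrite /D subrr unorm0 invr_ge0 exprn_ge0. Qed.

Lemma parameter_small t : v t <= (L ^+ 5)^-1 -> v t * r < v lincoef.
Proof.
move=> tL; rewrite vb (@le_lt_trans _ _ ((L ^+ 5)^-1 * L))//.
  by rewrite ler_pM ?unorm_ge0.
rewrite ltr_pdivrMl ?exprn_gt0// ltr_pdivlMr ?exprn_gt0//.
by rewrite -exprS ltr_eXn2l.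
Qed.

Let small := parameter_small.

Let small_lt t : v t <= (L ^+ 5)^-1 -> v t < v lincoef.
Proof.
by move=> /small; apply: le_lt_trans; rewrite ler_peMr ?unorm_ge0// ltW.
Qed.

Let small_lt1 t : v t <= (L ^+ 5)^-1 -> v t < 1.
Proof. by move=> /small_lt /lt_trans; apply. Qed.

Let D_small i t t' : v t <= (L ^+ 5)^-1 -> D i t t' -> v t' <= (L ^+ 5)^-1.
Proof.
move=> tL tt'; rewrite -(subrK t t') unormD_le// (le_trans tt')//.
by rewrite lef_pV2 ?posrE ?exprn_gt0// ler_eXn2l// /m_ /repel_time; (clear; lia).
Qed.

Lemma orbit_init : state 0 0.
Proof.
split; rewrite /orb /= ?hornerE//.
- by rewrite unorm0 invr_ge0 exprn_ge0.
- by move=> t' t'' _ _; rewrite !hornerE -mulrBr unormM opprD addrACA subrr addr0.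
Qed.

Let orbB i t j : state i t -> orb (n_ i + j) t = beta.
Proof.
move=> [h0 _ _]; elim: j => [|j IH]; first by rewrite addn0.
by rewrite addnS orbS IH family_beta.
Qed.

(** Each step multiplies the difference by L, and the new perturbation (t' - t'') (z - beta), of
    norm below r |t' - t''|, is dominated. *)
Let state_repel i t j : state i t -> (j <= m_ i)%N ->
  forall t' t'', D i t t' -> D i t t'' ->
  v (orb (n_ i + j) t' - orb (n_ i + j) t'') = r * L ^+ j * v (t' - t'').
Proof.
move=> st; elim: j => [|j IH] jm t' t'' Dt' Dt''.
  by rewrite addn0 expr0 mulr1; case: st => _ _ ->.
have near s : D i t s -> v (orb (n_ i + j) s - beta) < r.
  move=> Ds; rewrite -(orbB j st) IH ?(ltnW jm)// -mulrA gtr_pMr//.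
  rewrite (le_lt_trans (ler_wpM2l _ Ds)) ?exprn_ge0//.
  by rewrite ltr_pdivrMr ?exprn_gt0// mul1r ltr_eXn2l.
have tL : v t <= (L ^+ 5)^-1 by case: st.
rewrite addnS !orbS -(subrKA (family t').[orb (n_ i + j) t'']) family_param.
have [->|tt] := eqVneq t' t''.
  by rewrite !subrr mul0r addr0 unorm0 mulr0.
have tt0 : 0 < v (t' - t'') by rewrite unorm_gt0 subr_eq0.
have E : v ((family t').[orb (n_ i + j) t'] - (family t').[orb (n_ i + j) t'']) =
    r * L ^+ j.+1 * v (t' - t'').
  rewrite family_sub_near_beta ?near//; last by apply: small_lt1; exact: D_small Dt'.
  by rewrite IH ?(ltnW jm)// (exprS L) !mulrA [L * r]mulrC.
rewrite unormDr E// unormM mulrC ltr_pM2r// (lt_le_trans (near _ Dt''))//.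
by rewrite ler_peMr// exprn_ege1// ltW.
Qed.

Let state_near_beta i t j t' : state i t -> (j < m_ i)%N -> D i t t' ->
  v (orb (n_ i + j) t' - beta) < r.
Proof.
move=> st jm Dt'; rewrite -(orbB j st) (state_repel st) ?(ltnW jm)// -mulrA gtr_pMr//.
rewrite (le_lt_trans (ler_wpM2l _ Dt')) ?exprn_ge0//.
by rewrite ltr_pdivrMr ?exprn_gt0// mul1r ltr_eXn2l.
Qed.

Let orb_contract N M t s : v t <= (L ^+ 5)^-1 -> 1 <= s ->
  (forall j, (j < M)%N -> s ^+ (p ^ j) <= G) -> v (orb N t) <= s ->
  forall j, (j <= M)%N -> v (orb (N + j) t) <= s ^+ (p ^ j).
Proof.
move=> tL s1 sG Ns; elim=> [|j IH] jM; first by rewrite addn0 expn0 expr1.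
rewrite addnS orbS expnSr exprM family_near0_le ?small ?IH ?(ltnW jM)//.
  by rewrite (le_trans (IH (ltnW jM)))// sG.
by rewrite exprn_ege1.
Qed.

(** After the stay near beta, the orbits of the parameter disk cover |z| <= r. One parameter sends
    the orbit to 0 at that time, another to a p^M-th root of beta; M steps later their orbits lie in
    |z| <= 1 and on |z| = r, so the disk of parameters between them covers beta. *)
Let state_step i t : state i t -> exists t1, [/\ D i t t1, state i.+1 t1,
  forall t', D i.+1 t1 t' -> D i t t' &
  forall t', D i.+1 t1 t' -> forall j, (j < M_ i)%N ->
    v (orb (n_ i + m_ i + j) t') <= G].
Proof.
move=> st; have tL : v t <= (L ^+ 5)^-1 by case: st.
set N := (n_ i + m_ i)%N; set m := m_ i; set M := M_ i.
have isoN t' t'' : D i t t' -> D i t t'' ->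
    v (orb N t' - orb N t'') = r * L ^+ m * v (t' - t'').
  exact: state_repel.
have Lm0 : 0 < L ^+ m by rewrite exprn_gt0.
have rL0 : 0 < r * L ^+ m by rewrite mulr_gt0.
(* Its norm is the exact radius of the parameter disk, so the orbits of [t] and [t + d] are r apart
   at time [N]. *)
pose d := (beta ^+ (k * m))^-1.
have vd : v d = (L ^+ m)^-1 by rewrite /d unormV unormX exprM.
have Dd : D i t (t + d) by rewrite /D addrAC subrr add0r vd.
have orbNt : orb N t = beta by exact: orbB.
have vNd : v (orb N (t + d) - orb N t) = r.
  by rewrite isoN// addrAC subrr add0r vd mulfK// gt_eqF.
have coverN y : v y <= r -> exists2 t', orb N t' = y & D i t t'.
  move=> yr; have [|t' t'y t't] := @poly_covering _ _ v (orbit_poly N) t (t + d) y.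
    by rewrite -/(orb _ _) -/(orb _ _) vNd orbNt unormB_le.
  by exists t' => //; rewrite /D (le_trans t't)// addrAC subrr add0r vd.
have [ta ta0 Dta] : exists2 t', orb N t' = 0 & D i t t'.
  by apply: coverN; rewrite unorm0.
have M0 : (0 < M)%N by rewrite /M /M_ /contract_time; (clear; lia).
(* Norms between 1 and r are raised to the power p at each step, so from s = |y| they stay at most G
   before step M and equal r at step M. *)
have [y yb] := @nth_root K beta (p ^ M) (expn_gt0 _ _).
set s := v y; have sM : s ^+ (p ^ M) = r by rewrite /s -unormX yb.
have s0 : 0 <= s by exact: unorm_ge0.
have s1 : 1 < s.
  rewrite -(@expr_gt1 _ (p ^ M))// ?sM// expn_gt0//.
have sG j : (j < M)%N -> s ^+ (p ^ j) <= G.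
  move=> jM; rewrite (@le_trans _ _ (s ^+ (p ^ M.-1)))//.
    by rewrite ler_weXn2l ?(ltW s1)// leq_exp2l ?prime_gt1//; rewrite -ltnS prednK.
  rewrite -(@ler_pXn2r _ p)// ?nnegrE ?exprn_ge0//.
  by rewrite -exprM -expnSr prednK// sM rE.
have [tb tby Dtb] : exists2 t', orb N t' = y & D i t t'.
  apply: coverN; rewrite -/s -sM -[leLHS]expr1 ler_weXn2l ?(ltW s1)//.
  by rewrite expn_gt0.
have taL : v ta <= (L ^+ 5)^-1 by exact: D_small Dta.
have tbL : v tb <= (L ^+ 5)^-1 by exact: D_small Dtb.
have tabs : r * L ^+ m * v (tb - ta) = s by rewrite -isoN// tby ta0 subr0.
have vb_orb j : (j <= M)%N -> v (orb (N + j) tb) = s ^+ (p ^ j).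
  elim: j => [|j IH] jM; first by rewrite addn0 expn0 expr1 tby.
  rewrite addnS orbS family_mid ?small ?IH ?(ltnW jM)//.
    by rewrite expnSr exprM.
  by rewrite exprn_egt1 -?lt0n ?expn_gt0//= (le_lt_trans (sG _ jM)).
have va_orb : v (orb (N + M) ta) <= 1.
  rewrite -[leRHS](expr1n _ (p ^ M)); apply: (@orb_contract _ M) => //.
    by move=> j _; rewrite expr1n ltW.
  by rewrite ta0 unorm0.
have [t1 t1b t1a] : exists2 t', orb (N + M) t' = beta & v (t' - ta) <= v (tb - ta).
  apply: poly_covering; rewrite -!/(orb _ _) unormBl; last first.
    exact: le_lt_trans r_gt1.
  by rewrite unormBr vb_orb// sM// (le_lt_trans va_orb).
have Dt1 : D i t t1.
  apply: (unorm_triangle _ Dta); rewrite (le_trans t1a)//.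
  by apply: (unorm_triangle Dtb); rewrite unormBC; exact: Dta.
have t1L : v t1 <= (L ^+ 5)^-1 by exact: D_small Dt1.
have DS t' : D i.+1 t1 t' -> D i t t'.
  move=> Dt'; apply: (unorm_triangle _ Dt1); apply: (le_trans Dt').
  by rewrite lef_pV2 ?posrE ?exprn_gt0// ler_eXn2l// /m_ /repel_time; (clear; lia).
have orbN1 : v (orb N t1) <= s.
  by rewrite -tabs -[orb N t1]subr0 -ta0 isoN// ler_wpM2l// ltW.
(* The next parameter disk is smaller by the factor L^-6, which brings the differences at time [N]
   below the threshold r^-3 of the linear regime. *)
have rL6 : r * (L ^+ 6)^-1 <= (r ^+ 3)^-1.
  rewrite ler_pdivrMr ?exprn_gt0// ler_pdivlMl ?exprn_gt0// -exprSr.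
  rewrite (@le_trans _ _ (L ^+ 4))//; first by rewrite lerXn2r// nnegrE.
  by rewrite ler_weXn2l// ltW.
have DSL t' t'' : D i.+1 t1 t' -> D i.+1 t1 t'' ->
    r * L ^+ m * v (t' - t'') <= (r ^+ 3)^-1.
  move=> Dt' Dt''; apply: le_trans rL6; rewrite -mulrA ler_pM2l//.
  rewrite -ler_pdivlMl//; have : v (t' - t'') <= (L ^+ m_ i.+1)^-1.
    by apply: (unorm_triangle Dt'); rewrite unormBC; exact: Dt''.
  move=> /le_trans; apply; rewrite -invfM -exprD; have -> : (m_ i.+1 = m + 6)%N.
    by rewrite /m /m_ /repel_time; (clear; lia).
  by [].
have r3 : (r ^+ 3)^-1 <= 1 by rewrite invf_le1 ?exprn_gt0// exprn_ege1// ltW.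
have contr t' : D i.+1 t1 t' -> forall j, (j < M)%N -> v (orb (N + j) t') <= G.
  move=> Dt' j jM; apply: le_trans (sG _ jM).
  apply: (@orb_contract N M) => //; last exact: ltnW.
  - exact: D_small (DS _ Dt').
  - exact: ltW.
  - rewrite -[orb N t'](subrK (orb N t1)) unormD_le// isoN ?DS//.
    by rewrite (le_trans (DSL _ _ _ _))// (le_trans r3)// ltW.
exists t1; split => //; split => //.
  by rewrite /n_ block_startS.
move=> t' t'' Dt' Dt''; have [->|tt] := eqVneq t' t''.
  by rewrite !subrr unorm0 mulr0.
have tt0 : 0 < v (t' - t'') by rewrite unorm_gt0 subr_eq0.
have t'L : v t' <= (L ^+ 5)^-1 by exact: D_small (DS _ Dt').
(* The part of the difference inherited from before the stay near 0, contracted by |b| at each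
   step. *)
pose e j := v lincoef ^+ j * (r * L ^+ m * v (t' - t'')).
have e0 j : 0 <= e j by rewrite mulr_ge0 ?exprn_ge0 ?unorm_ge0// mulr_ge0 ?unorm_ge0// ltW.
have eS j : e j.+1 = v lincoef * e j by rewrite /e (exprS (v _)) -mulrA.
have far j : (j < M)%N ->
    v ((t' - t'') * (orb (N + j) t'' - beta)) = r * v (t' - t'').
  move=> jM; rewrite unormM mulrC unormBl// -/r.
  by rewrite (le_lt_trans (contr _ Dt'' _ jM)).
have lin j : (j < M)%N -> v (orb (N + j) t' - orb (N + j) t'') <= (r ^+ 3)^-1 ->
    v ((family t').[orb (N + j) t'] - (family t').[orb (N + j) t''])
      <= v lincoef * v (orb (N + j) t' - orb (N + j) t'').
  move=> jM le3.
  apply: le_trans (family_sub_near0_le _ _ _) _; rewrite ?contr ?small_lt//.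
  rewrite ge_max lexx andbT exprSr ler_wpM2r ?unorm_ge0// vb /L -exprM mulnC exprM.
  by rewrite -exprVn lerXn2r ?nnegrE ?unorm_ge0 ?invr_ge0 ?exprn_ge0.
have diffS j : orb (N + j.+1) t' - orb (N + j.+1) t'' =
    ((family t').[orb (N + j) t'] - (family t').[orb (N + j) t''])
    + (t' - t'') * (orb (N + j) t'' - beta).
  by rewrite addnS !orbS -family_param subrKA.
have le_r3 x j : x <= Num.max (e j) (r * v (t' - t'')) -> x <= (r ^+ 3)^-1.
  move=> /le_trans; apply; rewrite ge_max; apply/andP; split.
    apply: le_trans (DSL _ _ Dt' Dt''); rewrite ler_piMl//.
      by rewrite mulr_ge0 ?unorm_ge0// ltW.
    by rewrite exprn_ile1 ?unorm_ge0// ltW.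
  apply: le_trans (DSL _ _ Dt' Dt''); rewrite ler_pM2r// ler_peMr//.
  by rewrite exprn_ege1// ltW.
have le_e j : (j < M)%N ->
    v (orb (N + j) t' - orb (N + j) t'') <= Num.max (e j) (r * v (t' - t'')).
  elim: j => [|j IH] jM.
    by rewrite addn0 isoN ?DS// /e expr0 mul1r le_max lexx.
  have {IH}IH := IH (ltnW jM).
  rewrite diffS unormD_le//; last by rewrite far ?le_max ?lexx ?orbT// ltnW.
  rewrite (le_trans (lin _ (ltnW jM) (le_r3 _ _ IH)))//.
  rewrite (le_trans (ler_wpM2l (unorm_ge0 _ _) IH))// maxr_pMr ?unorm_ge0//.
  rewrite ge_max eS le_max lexx/= le_max; apply/orP; right.
  by rewrite ler_piMl ?(ltW vb_lt1)// mulr_ge0 ?unorm_ge0.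
have {}IH := le_e M.-1; rewrite prednK// leqnn in IH.
rewrite /n_ block_startS -/m_ -/M_ -/n_ -/N -/M.
have -> : (N + M = N + M.-1.+1)%N by rewrite prednK.
have MM : (M.-1 < M)%N by rewrite prednK.
rewrite diffS unormDl far//.
apply: le_lt_trans (lin _ MM (le_r3 _ _ (IH isT))) _.
apply: le_lt_trans (ler_wpM2l (unorm_ge0 _ _) (IH isT)) _.
(* The inherited part is below r |t' - t''| since m < 3M, so the last perturbation alone determines
   the norm. *)
rewrite maxr_pMr ?unorm_ge0// gt_max; apply/andP; split.
  rewrite -eS prednK// /e mulrA ltr_pM2r// mulrCA gtr_pMr//.
  rewrite vb exprVn -exprM mulrC ltr_pdivrMr ?exprn_gt0// mul1r ltr_eXn2l//.
  by rewrite /m /M /m_ /M_ /repel_time /contract_time; clear; lia.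
by rewrite gtr_pMl// mulr_gt0.
Qed.

(** The parameter disks are nested with radii tending to 0, so their centers converge to a point
    common to all of them. *)
Lemma exists_parameter : complete_norm v -> exists t, v t <= (L ^+ 5)^-1 /\
  forall i, (forall j, (j < repel_time i)%N ->
      v ((orbit_poly (block_start i + j)).[t] - beta) < r) /\
    (forall j, (j < contract_time i)%N ->
      v (orbit_poly (block_start i + repel_time i + j)).[t] <= G).
Proof.
move=> vcompl.
have /choice[step stepP] : forall it : nat * K, exists t1, state it.1 it.2 ->
    [/\ D it.1 it.2 t1, state it.1.+1 t1,
    forall t', D it.1.+1 t1 t' -> D it.1 it.2 t' &
    forall t', D it.1.+1 t1 t' -> forall j, (j < M_ it.1)%N ->
    v (orb (n_ it.1 + m_ it.1 + j) t') <= G].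
  move=> [i t] /=; have [/state_step[t1 h]|nst] := pselect (state i t).
    by exists t1.
  by exists 0.
pose fix u i : K := if i is i'.+1 then step (i', u i') else 0.
have ust i : state i (u i).
  elim: i => [|i IH]; first exact: orbit_init.
  by have [] := stepP (i, u i) IH.
have uD i t' : D i.+1 (u i.+1) t' -> D i (u i) t'.
  by have [_ _ + _] := stepP (i, u i) (ust i); apply.
have uuD i j : D i (u i) (u (i + j)%N).
  elim: j i => [|j IH] i; first by rewrite addn0; exact: DC.
  by apply: uD; rewrite addnS -addSn; exact: IH.
have [e|l ul] := vcompl u.
  move=> e0; have [n en] := expr_unbounded e^-1 L_gt1.
  have ne : (L ^+ m_ n)^-1 < e.
    rewrite invf_plt ?posrE ?exprn_gt0// (lt_le_trans en)// ler_weXn2l ?(ltW L_gt1)//.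
    by rewrite /m_ /repel_time; clear; lia.
  near=> a b; rewrite (le_lt_trans _ ne)//.
  have an : (n <= a)%N by near: a; exists n.
  have bn : (n <= b)%N by near: b; exists n.
  apply: (@unorm_triangle _ _ _ _ (u n)).
    by have := uuD n (a - n)%N; rewrite subnKC.
  by rewrite unormBC; have := uuD n (b - n)%N; rewrite subnKC.
have Dl i : D i (u i) l.
  have /(cvgr_lt 0)/(_ (L ^+ m_ i)^-1) : v (u n - l) @[n --> \oo] --> (0 : R) by [].
  rewrite invr_gt0 exprn_gt0// => /(_ isT)[n _ nP].
  apply: (@unorm_triangle _ _ _ _ (u (i + n)%N)); last exact: uuD.
  by rewrite unormBC ltW// nP//= leq_addl.
exists l; split => [|i].
  by have := Dl 0; rewrite /D subr0.
split=> j ji; first exact: (state_near_beta (ust i)).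
have [_ _ _] := stepP (i, u i) (ust i); apply => //; exact: Dl.
Unshelve. all: by end_near. Qed.

Lemma orbit_poly_iter n m t :
  (orbit_poly (n + m)).[t] = iter m (horner (family t)) (orbit_poly n).[t].
Proof.
by elim: m => [|m IH]; rewrite ?addn0// addnS orbit_polyS IH.
Qed.

(** * Contraction and expansion around a point with the prescribed itinerary *)

Section Dynamics.
Variables (t z0 : K).
Hypothesis t_small : v t * r < v lincoef.

Let F := horner (family t).
(** The start of the stay near 0 of index i, with time counted from the end of the first stay near
    beta. *)
Let T i := (4 * i * i + 11 * i)%N.

Hypothesis hA : forall i j, (j < contract_time i)%N -> v (iter (T i + j) F z0) <= G.
Hypothesis hB : forall i j, (j < repel_time i.+1)%N ->
  v (iter (T i + contract_time i + j) F z0 - beta) < r.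

Let TS i : T i.+1 = (T i + contract_time i + repel_time i.+1)%N.
Proof. by rewrite /T /repel_time /contract_time; clear; lia. Qed.

Let tb : v t < v lincoef.
Proof. by apply: le_lt_trans t_small; rewrite ler_peMr ?unorm_ge0// ltW. Qed.

Let t_lt1 : v t < 1. Proof. exact: lt_trans vb_lt1. Qed.

Let r1 : r^-1 < 1. Proof. by rewrite invf_lt1. Qed.
Let rV_gt0 : 0 < r^-1. Proof. by rewrite invr_gt0. Qed.

Let vbE : v lincoef = r^-1 ^+ (3 * k).
Proof. by rewrite vb /L -exprM mulnC exprVn. Qed.

Let lin_le z w : v z <= G -> v w <= G -> v (z - w) <= r^-1 ^+ 3 ->
  v (F z - F w) <= v lincoef * v (z - w).
Proof.
move=> zG wG zw; apply: (le_trans (family_sub_near0_le zG wG tb)).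
rewrite ge_max lexx andbT exprSr ler_wpM2r ?unorm_ge0// vbE exprM.
by rewrite lerXn2r// nnegrE ?unorm_ge0// exprn_ge0// ltW.
Qed.

(** At distance r^-2 the power may still dominate; after one step the bound r^(-2p) is below r^-3,
    and all later steps contract by |b|. *)
Let contract_run x w M : (forall j, (j < M)%N -> v (iter j F x) <= G) ->
  v (w - x) <= r^-1 ^+ 2 -> forall j, (j < M)%N ->
  v (iter j.+1 F w - iter j.+1 F x) <= r^-1 ^+ (2 * p) * v lincoef ^+ j.
Proof.
move=> xG wx.
have nearG n y : v y <= G -> v (n - y) <= 1 -> v n <= G.
  by move=> yG ny; rewrite -(subrK y n) unormD_le// (le_trans ny)// ltW.
elim=> [|j IH] jM.
  rewrite expr0 mulr1 (le_trans (family_sub_near0_le _ (xG _ jM) tb))//.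
    apply: nearG (xG _ jM) _; rewrite (le_trans wx)// exprn_ile1 ?ltW//.
  rewrite ge_max exprM lerXn2r ?nnegrE ?unorm_ge0 ?exprn_ge0 ?(ltW rV_gt0)//=.
  rewrite (le_trans (ler_wpM2l (unorm_ge0 _ _) wx))// vbE -!exprM -exprD.
  by rewrite ler_wiXn2l ?(ltW rV_gt0) ?(ltW r1)// /p; clear; lia.
have {}IH := IH (ltnW jM).
have small3 : r^-1 ^+ (2 * p) * v lincoef ^+ j <= r^-1 ^+ 3.
  rewrite (@le_trans _ _ (r^-1 ^+ (2 * p)))//.
    by rewrite ler_piMr ?exprn_ge0 ?(ltW rV_gt0)// exprn_ile1 ?unorm_ge0 ?(ltW vb_lt1).
  by rewrite ler_wiXn2l ?(ltW rV_gt0) ?(ltW r1)// /p; clear -k_gt0; lia.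
rewrite iterS [iter j.+2 F x]iterS.
have xj := xG _ jM.
rewrite (le_trans (lin_le _ xj _))//.
- apply: nearG xj _; rewrite (le_trans IH)// (le_trans small3)//.
  by rewrite exprn_ile1 ?ltW.
- exact: le_trans small3.
- by rewrite (exprS (v _)) [leRHS]mulrCA ler_wpM2l ?unorm_ge0.
Qed.

Let repel_run x w m : (forall j, (j < m)%N -> v (iter j F x - beta) < r) ->
  L ^+ m * v (w - x) <= r -> forall j, (j <= m)%N ->
  v (iter j F w - iter j F x) = L ^+ j * v (w - x).
Proof.
move=> xb wx; have [->|wx0] := eqVneq w x.
  by move=> j _; rewrite !subrr unorm0 mulr0.
have wx_gt0 : 0 < v (w - x) by rewrite unorm_gt0 subr_eq0.
elim=> [|j IH] jm; first by rewrite expr0 mul1r.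
have {}IH := IH (ltnW jm).
rewrite !iterS family_sub_near_beta ?xb//; first by rewrite IH mulrA -exprS.
apply: unorm_triangle_lt (xb _ jm); rewrite IH (lt_le_trans _ wx)//.
by rewrite ltr_pM2r// ltr_eXn2l.
Qed.

Let r2 := r^-1 ^+ 2.

Let block_dist i w : v (iter (T i) F w - iter (T i) F z0) <= r2 ->
  forall j, (j <= contract_time i + repel_time i.+1)%N ->
  v (iter (T i + j) F w - iter (T i + j) F z0) <= r2.
Proof.
move=> h j; set x := iter (T i) F z0 in h *; set y := iter (T i) F w in h *.
set M := contract_time i; set m := repel_time i.+1.
have itE n s : iter (T i + n) F s = iter n F (iter (T i) F s).
  by rewrite addnC iterD.
have cr := @contract_run x y M.
have xG l : (l < M)%N -> v (iter l F x) <= G by move=> lM; rewrite -itE; exact: hA.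
have {}cr := cr xG h.
have r2p : r^-1 ^+ (2 * p) <= r2.
  by rewrite ler_wiXn2l ?(ltW rV_gt0) ?(ltW r1)// /p; clear; lia.
have M0 : (0 < M)%N by rewrite /M /contract_time; clear; lia.
have le_M l : (l <= M)%N -> v (iter l F y - iter l F x) <= r2.
  case: l => [//|l] lM; rewrite (le_trans (cr _ lM))//.
  apply: le_trans r2p; rewrite ler_piMr ?exprn_ge0 ?(ltW rV_gt0)//.
  by rewrite exprn_ile1 ?unorm_ge0 ?(ltW vb_lt1).
rewrite !itE -/x -/y => jMm; have [|Mj] := leqP j M; first exact: le_M.
have xB l : (l < m)%N -> v (iter l F (iter M F x) - beta) < r.
  by move=> lm; rewrite -iterD [(l + M)%N]addnC -itE addnA; exact: hB.
have bound : L ^+ m * v (iter M F y - iter M F x) <= r2.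
  have := cr M.-1; rewrite prednK// leqnn => /(_ isT) crM.
  rewrite (le_trans (ler_wpM2l (exprn_ge0 _ L_ge0) crM))//.
  have -> : v lincoef ^+ M.-1 = (L ^+ (3 * M.-1))^-1 by rewrite vb exprVn -exprM.
  rewrite mulrCA -[leRHS]mulr1 /r2.
  (* All but two of the m = 3 (M - 1) + 2 expanding steps compensate the linear contraction; the
     remaining gain L^2 = r^(2k) turns r^(-2p) back into r^-2. *)
  have -> : L ^+ m / L ^+ (3 * M.-1) = r ^+ (2 * k).
    have -> : m = (2 + 3 * M.-1)%N.
      by rewrite /m /M /contract_time /repel_time; clear; lia.
    by rewrite exprD mulfK ?expf_neq0 ?gt_eqF// -exprM mulnC.
  have -> : (2 * p = 2 + 2 * k)%N by rewrite /p; clear; lia.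
  by rewrite exprD -mulrA [_ ^+ (2 * k)]exprVn mulVf ?expf_neq0 ?gt_eqF.
have m_ge : (j - M <= m)%N by rewrite leq_subLR.
rewrite -(subnK (ltnW Mj)) (iterD _ M F y) (iterD _ M F x) (repel_run xB _ m_ge)//.
  rewrite (le_trans _ bound)// ler_wpM2r ?unorm_ge0// ler_weXn2l ?(ltW L_gt1)//.
rewrite (le_trans bound)// (le_trans _ (ltW r_gt1))//.
by rewrite exprn_ile1 ?ltW.
Qed.

Let disk_dist i w : v (w - z0) <= r2 -> v (iter (T i) F w - iter (T i) F z0) <= r2.
Proof.
move=> wz; elim: i => [//|i IH].
by have := block_dist IH (leqnn _); rewrite addnA -TS.
Qed.

Let block_decomp n : exists i j, n = (T i + j)%N /\
  (j < contract_time i + repel_time i.+1)%N.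
Proof.
elim: n => [|n [i [j [-> jlt]]]]; first by exists 0%N, 0%N; split=> //.
have [jE|jE] := ltnP j.+1 (contract_time i + repel_time i.+1).
  by exists i, j.+1; rewrite addnS.
exists i.+1, 0%N; rewrite TS addn0 -addnS -addnA; split; last first.
  by rewrite addnC /contract_time /repel_time; clear; lia.
by congr (_ + _)%N; apply/eqP; rewrite eqn_leq jlt.
Qed.

Let disk_contract i j w : v (w - z0) <= r2 -> (j < contract_time i)%N ->
  v (iter (T i + j) F w) <= G.
Proof.
move=> wz jM; rewrite -[iter _ F w](subrK (iter (T i + j) F z0)).
rewrite unormD_le ?hA//.
apply: le_trans (block_dist (disk_dist i wz) _) _; first exact: ltnW (ltn_addr _ jM).
by rewrite (@le_trans _ _ 1) ?(ltW G_gt1)// exprn_ile1 ?ltW.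
Qed.

Let disk_repel i j w : v (w - z0) <= r2 -> (j < repel_time i.+1)%N ->
  v (iter (T i + contract_time i + j) F w) = r.
Proof.
move=> wz jm; apply: unorm_close; apply: unorm_triangle_lt (hB jm).
rewrite -addnA; apply: le_lt_trans (block_dist (disk_dist i wz) _) _.
  by rewrite leq_add2l ltnW.
by rewrite (@le_lt_trans _ _ 1) ?exprn_ile1 ?ltW.
Qed.

Lemma disk_itinerary n :
  (forall w, v (w - z0) <= r^-1 ^+ 2 -> v (iter n F w) <= G) \/
  (forall w, v (w - z0) <= r^-1 ^+ 2 -> v (iter n F w) = r).
Proof.
have [i [j [-> jlt]]] := block_decomp n.
have [jM|Mj] := ltnP j (contract_time i).
  by left => w wz; exact: disk_contract.
right=> w wz; rewrite -(subnKC Mj) addnA disk_repel//.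
by rewrite ltn_subLR.
Qed.

(** From the last step of a late stay near beta, d further steps end inside the next stay near 0,
    because these stays become arbitrarily long. *)
Lemma disk_itinerary_aperiodic n0 d : (0 < d)%N -> exists n, [/\ (n0 <= n)%N,
  forall w, v (w - z0) <= r^-1 ^+ 2 -> v (iter n F w) = r &
  forall w, v (w - z0) <= r^-1 ^+ 2 -> v (iter (n + d) F w) <= G].
Proof.
move=> d0; pose i := (n0 + d)%N.
have m0 : (0 < repel_time i.+1)%N by rewrite /repel_time addnS.
exists (T i + contract_time i + (repel_time i.+1).-1)%N; split.
- by rewrite /T /i -!addnA; clear; lia.
- by move=> w wz; rewrite disk_repel// prednK.
- move=> w wz; rewrite -(prednK d0) addnS -addSn -addnS prednK// -TS.
  by rewrite disk_contract// /contract_time /i; move: d0; clear; lia.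
Qed.

Let F_sub_expr z w : v z <= G -> v w <= G -> v lincoef < v (z - w) ^+ k ->
  v (F z - F w) = v (z - w) ^+ p.
Proof. by move=> zG wG; exact: family_sub_near0_expr. Qed.

Let nontriv : nontrivial_norm v.
Proof. by exists g; rewrite -?(unorm_gt0 v)// gt_eqF. Qed.

(** A p-th root [h0] of y - F(x) has norm below [rho]; density provides [h] with |h| between
    max(r^-3, |h0|) and [rho], where the power regime gives the norm of F(x + h) - F(x). *)
Let covering_expr x rho y : v x <= G -> r^-1 ^+ 3 < rho -> rho <= 1 ->
  v (y - F x) < rho ^+ p -> exists2 z, F z = y & v (z - x) < rho.
Proof.
move=> xG rho3 rho1 yx.
have rho0 : 0 < rho by rewrite (lt_trans _ rho3)// exprn_gt0.
have [h0 h0E] := @nth_root K (y - F x) p isT.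
have h0rho : v h0 < rho.
  by rewrite -(@ltr_pXn2r _ p)// ?nnegrE ?unorm_ge0 ?(ltW rho0)// -unormX h0E.
have m_lt : Num.max (r^-1 ^+ 3) (v h0) < rho by rewrite gt_max rho3.
have m_ge : 0 <= Num.max (r^-1 ^+ 3) (v h0) by rewrite le_max unorm_ge0 orbT.
have [h /andP[]] := unorm_dense nontriv m_ge m_lt.
rewrite gt_max => /andP[h3 h0h] hrho.
have xh : x + h - x = h by rewrite addrAC subrr add0r.
have E : v (F (x + h) - F x) = v h ^+ p.
  rewrite F_sub_expr ?xh//.
    by rewrite unormD_le// (le_trans (ltW hrho))// (le_trans rho1)// ltW.
  rewrite vbE exprM ltrXn2r ?h3 ?exprn_ge0 ?(ltW rV_gt0)//.
  by rewrite -lt0n.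
have [|z zy zx] := @poly_covering _ _ v (family t) x (x + h) y.
  rewrite E unormBC -h0E unormX lerXn2r ?nnegrE ?unorm_ge0//; exact: ltW.
by exists z => //; rewrite (le_lt_trans zx)// xh.
Qed.

Let covering_lin x rho y : v x <= G -> rho <= 1 ->
  v (y - F x) < v lincoef * rho -> exists2 z, F z = y & v (z - x) < rho.
Proof.
move=> xG rho1 yx.
have rho0 : 0 < rho.
  by rewrite -(pmulr_rgt0 _ vb_gt0) (le_lt_trans _ yx)// unorm_ge0.
(* Above the threshold the power regime covers an even larger disk, since rho^k > |b|. *)
have [rho3|rho3] := ltP (r^-1 ^+ 3) rho.
  apply: covering_expr => //; rewrite (lt_trans yx)// exprSr ltr_pM2r//.
  by rewrite vbE exprM ltrXn2r ?exprn_ge0 ?(ltW rV_gt0)// -lt0n.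
have b0 : lincoef != 0 by rewrite -(unorm_gt0 v).
pose h := (y - F x) / lincoef.
have vh : v lincoef * v h = v (y - F x) by rewrite -unormM mulrC divfK.
have hrho : v h < rho by rewrite -(ltr_pM2l vb_gt0) vh.
have xh : x + h - x = h by rewrite addrAC subrr add0r.
have E : v (F (x + h) - F x) = v lincoef * v h.
  rewrite family_sub_near0_lin ?xh//.
    by rewrite unormD_le// (le_trans (ltW hrho))// (le_trans rho1)// ltW.
  rewrite vbE exprM ltrXn2r -?lt0n ?unorm_ge0//.
  exact: lt_le_trans rho3.
have [|z zy zx] := @poly_covering _ _ v (family t) x (x + h) y.
  by rewrite E vh unormBC.
by exists z => //; rewrite (le_lt_trans zx)// xh.
Qed.

Let covering_repel x rho y : v (x - beta) < r -> rho <= r ->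
  v (y - F x) < L * rho -> exists2 z, F z = y & v (z - x) < rho.
Proof.
move=> xb rhor yx; pose h := (y - F x) / beta ^+ k.
have vh : L * v h = v (y - F x).
  by rewrite /L -unormX -unormM mulrC divfK// expf_neq0.
have hrho : v h < rho by rewrite -(ltr_pM2l L_gt0) vh.
have xh : x + h - x = h by rewrite addrAC subrr add0r.
have E : v (F (x + h) - F x) = L * v h.
  rewrite family_sub_near_beta ?xh// addrAC unormD_lt//.
  exact: lt_le_trans rhor.
have [|z zy zx] := @poly_covering _ _ v (family t) x (x + h) y.
  by rewrite E vh unormBC.
by exists z => //; rewrite (le_lt_trans zx)// xh.
Qed.

(* A disk of radius [rho > r^-2] at the beginning of a stay near 0 has radius at
   least [rho^p L^2 = rho (r^2 rho)^(p-1)] at the beginning of the next one. *)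
Section Expansion.
Variable rho0 : R.
Hypothesis rho0_gt : r2 < rho0.

Let covers n rho := forall y, v (y - iter n F z0) < rho ->
  exists2 w, iter n F w = y & v (w - z0) < rho0.

Let covers_le n rho rho' : rho' <= rho -> covers n rho -> covers n rho'.
Proof. by move=> le_rho c y ylt; apply: c; exact: lt_le_trans le_rho. Qed.

Let covers_contract n M rho : (forall j, (j < M)%N -> v (iter (n + j) F z0) <= G) ->
  r^-1 ^+ 3 < rho -> rho <= 1 -> covers n rho ->
  forall j, (j < M)%N -> covers (n + j.+1) (v lincoef ^+ j * rho ^+ p).
Proof.
move=> nG rho3 rho1 c; elim=> [|j IH] jM y.
  rewrite expr0 mul1r addn1 iterS => yF.
  have := nG _ jM; rewrite addn0 => nG0.
  have [z zy /c[w wz wr]] := covering_expr nG0 rho3 rho1 yF.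
  by exists w => //; rewrite iterS wz.
rewrite addnS iterS exprS -mulrA => yF.
have le1 : v lincoef ^+ j * rho ^+ p <= 1.
  have rho_ge0 : 0 <= rho by rewrite ltW// (lt_trans _ rho3)// exprn_gt0.
  by rewrite mulr_ile1 ?exprn_ge0 ?exprn_ile1 ?unorm_ge0 ?(ltW vb_lt1).
have [z zy zlt] := covering_lin (nG _ jM) le1 yF.
have [w wz wr] := IH (ltnW jM) _ zlt.
by exists w => //; rewrite iterS wz.
Qed.

Let covers_repel n m rho :
  (forall j, (j < m)%N -> v (iter (n + j) F z0 - beta) < r) ->
  0 <= rho -> L ^+ m * rho <= r -> covers n rho ->
  forall j, (j <= m)%N -> covers (n + j) (L ^+ j * rho).
Proof.
move=> nb rho_ge0 rhor c; elim=> [|j IH] jm; first by rewrite addn0 expr0 mul1r.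
rewrite addnS exprS -mulrA => y yF.
have ler : L ^+ j * rho <= r.
  by rewrite (le_trans _ rhor)// ler_wpM2r// ler_weXn2l ?(ltW L_gt1)// ltnW.
have [z zy zlt] := covering_repel (nb _ jm) ler yF.
have [w wz wr] := IH (ltnW jm) _ zlt.
by exists w => //; rewrite iterS wz.
Qed.

Let covers_block i rho rho' : r^-1 ^+ 3 < rho -> rho <= 1 -> 0 <= rho' ->
  rho' <= r -> rho' <= rho ^+ p * L ^+ 2 -> covers (T i) rho -> covers (T i.+1) rho'.
Proof.
move=> rho3 rho1 rho'0 rho'r rho'rho c.
have M0 : (0 < contract_time i)%N by rewrite /contract_time addnS.
have := covers_contract (@hA i) rho3 rho1 c.
move=> /(_ (contract_time i).-1); rewrite prednK// leqnn => /(_ isT) cM.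
set m := repel_time i.+1.
have Lm0 : 0 < L ^+ m by rewrite exprn_gt0.
have cm : covers (T i + contract_time i) (rho' / L ^+ m).
  apply: covers_le cM; rewrite ler_pdivrMr// vb exprVn -(exprM L).
  have -> : m = (3 * (contract_time i).-1 + 2)%N.
    by rewrite /m /contract_time /repel_time; clear; lia.
  by rewrite (exprD L) mulrACA mulVf ?mul1r// gt_eqF// exprn_gt0.
rewrite TS -/m -[rho'](divfK (lt0r_neq0 Lm0)) mulrC.
apply: (@covers_repel (T i + contract_time i) m (rho' / L ^+ m)) => //.
- by move=> j jm; exact: hB.
- by rewrite divr_ge0 ?(ltW Lm0).
- by rewrite mulrC divfK// lt0r_neq0.
Qed.

(** The ratio of [rho0] to the invariant radius r^-2. *)
Let e := rho0 * r ^+ 2.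

Let e_gt1 : 1 < e.
Proof.
by rewrite /e -ltr_pdivrMr ?exprn_gt0// mul1r -exprVn.
Qed.

Let L2_ge : r <= L ^+ 2.
Proof. by rewrite (le_trans r_le_L)// -[leLHS]expr1 ler_weXn2l ?(ltW L_gt1). Qed.

(** A block raises the ratio of the radius to r^-2 to the power p; the crude bound i + 2 <= (i + 1)
    p already gives unbounded growth. The minimum with 1 serves the condition [rho <= 1] of
    [covers_block]. *)
Let covers_growth i : covers (T i) (Num.min 1 (r2 * e ^+ i.+1)).
Proof.
have r2_gt0 : 0 < r2 by rewrite exprn_gt0.
elim: i => [|i IH].
  apply: (@covers_le _ rho0); last by move=> y yz; exists y.
  rewrite ge_min; apply/orP; right; rewrite expr1 /e /r2 mulrCA exprVn.
  by rewrite mulVf ?mulr1// gt_eqF// exprn_gt0.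
apply: covers_block IH.
- rewrite lt_min exprn_ilt1 ?(ltW rV_gt0)//= exprSr -/r2 ltr_pM2l//.
  by rewrite (lt_trans r1)// exprn_egt1.
- by rewrite ge_min lexx.
- by rewrite le_min ler01 mulr_ge0 ?exprn_ge0 ?(ltW rV_gt0) ?(ltW (lt_trans ltr01 e_gt1)).
- by rewrite ge_min ltW.
- have [h|h] := leP 1 (r2 * e ^+ i.+1).
    rewrite expr1n mul1r ge_min; apply/orP; left.
    by rewrite exprn_ege1// ltW.
  rewrite ge_min; apply/orP; right.
  have e0 : 0 <= e by rewrite ltW// (lt_trans _ e_gt1).
  have -> : (r2 * e ^+ i.+1) ^+ p * L ^+ 2 = r2 * (e ^+ i.+1) ^+ p.
    have E : r2 ^+ p * L ^+ 2 = r2.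
      rewrite /r2 -exprM; have -> : (2 * p = 2 + 2 * k)%N by rewrite /p; clear; lia.
      rewrite exprD -mulrA [_ ^+ (2 * k)]exprVn /L -exprM mulnC.
      by rewrite mulVf ?mulr1// gt_eqF// exprn_gt0.
    by rewrite exprMn mulrAC E.
  rewrite ler_pM2l// -exprM ler_weXn2l ?(ltW e_gt1)//.
  by rewrite /p; clear -k_gt0; nia.
Qed.

Let covers_large : exists i, covers (T i) r.
Proof.
have [n en] := expr_unbounded (r ^+ 2) e_gt1.
have := @covers_growth n; rewrite min_l; last first.
  rewrite /r2 exprVn ler_pdivlMl ?exprn_gt0// mulr1 ltW// (lt_le_trans en)//.
  by rewrite ler_weXn2l ?(ltW e_gt1).
move=> c1; exists n.+1; apply: covers_block c1 => //.
  by rewrite exprn_ilt1// ltW.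
by rewrite expr1n mul1r.
Qed.

(** At the start of some stay near 0 the disk covers the r-disk around the orbit, which contains a
    preimage y of beta with |y| <= G. A point leading to y is not within r^-2 of [z0], since such
    points remain in |z| <= G one step later. *)
Lemma beta_preimage_near_disk :
  exists w n, [/\ r^-1 ^+ 2 < v (w - z0), v (w - z0) < rho0 & iter n F w = beta].
Proof.
have [i c] := covers_large.
have F0 : v (F 0) <= 1.
  rewrite -[leRHS](expr1n _ p); apply: family_near0_le => //;
  by rewrite unorm0 ?ler01.
have Fg : v (F g) = r by rewrite /F family_mid ?G_gt1.
have F0r : v (F 0) < r by exact: le_lt_trans F0 r_gt1.
have E1 : v (F 0 - beta) = r by rewrite unormBl.
have E2 : v (F g - F 0) = r by rewrite unormBr Fg.
have [|y yb yg] := @poly_covering _ _ v (family t) 0 g beta.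
  by move: E1 E2; rewrite /F => -> ->.
rewrite !subr0 in yg.
have M0 : (1 < contract_time i)%N by rewrite /contract_time !addnS.
have Tz : v (iter (T i) F z0) <= G by have := @hA i 0; rewrite addn0; apply; exact: ltnW.
have [|w wy wz] := c y; first by rewrite (le_lt_trans _ G_lt_r)// unormB_le.
exists w, (T i).+1; split=> //; last by rewrite iterS wy.
rewrite ltNge; apply/negP => wz2.
have := disk_contract wz2 M0; rewrite addn1 iterS wy [F y]yb.
by rewrite leNgt G_lt_r.
Qed.

End Expansion.

Let escape n z : r < v z -> r ^+ n * v z <= v (iter n F z).
Proof.
move=> zr; elim: n => [|n IH]; first by rewrite expr0 mul1r.
have zn : r < v (iter n F z).
  by rewrite (lt_le_trans zr)// (le_trans _ IH)// ler_peMl ?unorm_ge0// exprn_ege1// ltW.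
rewrite iterS exprS -mulrA (le_trans _ (ltW (family_escape t_lt1 zn)))//.
by rewrite ler_pM2l.
Qed.

Let iter_beta n : iter n F beta = beta.
Proof. by elim: n => [//|n IH]; rewrite iterS IH /F family_beta. Qed.

Lemma size_family : (2 < size (family t))%N.
Proof.
have cq : (family t)`_q = topcoef.
  rewrite /family !coefE /q /p.
  have -> : ((5 * k.+1).+1 == k.+1) = false by apply/eqP; clear; lia.
  have -> : ((5 * k.+1).+1 == 1)%N = false by apply/eqP; clear; lia.
  by rewrite eqxx/= subr0 !mulr0 mulr1 !add0r addr0.
rewrite ltnNge; apply/negP => le2; move: vc; rewrite -cq nth_default.
  by rewrite unorm0 mul0r => /esym/eqP; rewrite oner_eq0.
by rewrite (leq_trans le2)// /q /p; clear; lia.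
Qed.

(** At time [N] the disk around [c] covers a small disk around beta, which repulsion enlarges until
    it contains a point of norm strictly between G and r. That point is sent beyond r and escapes,
    while the orbit of [c] stays at beta, so the images cover arbitrarily large disks. *)
Lemma beta_preimage_expanding c N s C : iter N F c = beta -> 0 < s ->
  exists n, forall y, v y <= C -> exists2 z, iter n F z = y & v (z - c) <= s.
Proof.
move=> cb s0.
have sN : (1 < size (poly_iter (family t) N))%N.
  by rewrite size_poly_iter// ltnW// size_family.
have [d d0 dP] := poly_open_map v c sN s0.
have [j jd] := expr_unbounded (r / d) L_gt1.
pose h := beta / beta ^+ (k * j).
have vh : L ^+ j * v h = r.
  rewrite /h unormM unormV unormX exprM -/L -/r mulrCA mulfV ?mulr1//.
  by rewrite expf_neq0// gt_eqF.
have hd : v h < d.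
  by move: jd; rewrite ltr_pdivrMr// -vh ltr_pM2l// exprn_gt0.
have bh : beta + h - beta = h by rewrite addrAC subrr add0r.
have jr : v (iter j F (beta + h) - iter j F beta) = r.
  rewrite (@repel_run _ _ j) ?bh ?vh//.
  by move=> i _; rewrite iter_beta subrr unorm0.
have [y /andP[Gy yr]] := unorm_dense nontriv G_ge0 G_lt_r.
have [|w wy wh] := @poly_covering _ _ v (poly_iter (family t) j) beta (beta + h) y.
  by rewrite !horner_poly_iter -/F jr iter_beta unormBr.
rewrite horner_poly_iter -/F in wy; rewrite bh in wh.
have [|x xw xc] := dP w.
  by rewrite horner_poly_iter -/F cb unormBC (le_lt_trans wh).
rewrite horner_poly_iter -/F in xw.
have Fy : r < v (F y).
  rewrite /F family_mid ?yr ?(lt_trans G_gt1)// [ltLHS]rE ltr_pXn2r//.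
  by rewrite nnegrE unorm_ge0.
have [n nC] := expr_unbounded C r_gt1.
exists (n + (1 + (j + N)))%N => y' y'C.
set l := (n + _)%N.
have lx : iter l F x = iter n F (F y) by rewrite /l !iterD xw wy.
have big_r : r < v (iter l F x).
  rewrite lx (lt_le_trans Fy)// (le_trans _ (escape _ Fy))//.
  by rewrite ler_peMl ?unorm_ge0// exprn_ege1// ltW.
have big_C : C <= v (iter l F x).
  rewrite lx (le_trans _ (escape _ Fy))// (le_trans (ltW nC))//.
  by rewrite ler_peMr ?exprn_ge0// (le_trans (ltW r_gt1))// ltW.
have lc : iter l F c = beta by rewrite /l !iterD cb !iter_beta.
have [|z zy zc] := @poly_covering _ _ v (poly_iter (family t) l) c x y'.
  rewrite !horner_poly_iter -/F lc [leRHS]unormBr//.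
  by rewrite unormB_le ?(ltW big_r)// (le_trans y'C).
by exists z; [rewrite -zy horner_poly_iter | exact: le_trans xc].
Qed.

End Dynamics.

End Family.

(** * Residue characteristic and choice of the coefficients *)

Lemma residue_pchar_lt1 (R : realType) (K : fieldType)
    (v : ultrametric_norm R K) p :
  p \in [pchar residue_field v] -> prime p /\ v p%:R < 1.
Proof.
rewrite inE => /andP[p_prime /eqP p0]; split=> //.
have : (p%:R : valuation_ring v) \in @maximal_ideal R K v.
  rewrite -[p%:R]subr0 (Quotient.idealrBE (@maximal_ideal R K v)); apply/eqP.
  have := rmorph_nat (\pi_({ideal_quot (@maximal_ideal R K v)})) p.
  by rewrite [RHS]p0 => ->; rewrite [RHS]rmorph0.
have /= pE := rmorph_nat (\val : valuation_ring v -> K) p.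
by rewrite inE /= pE.
Qed.

(** What the Berkovich part needs, freed from the coefficients: [a] and [b] are G and r, and [e] of
    norm r^-2 puts the radius in the value group. *)
Lemma exists_wandering_disk (R : realType) (K : closedFieldType)
    (v : ultrametric_norm R K) p :
  nontrivial_norm v -> complete_norm v -> prime p -> v p%:R < 1 ->
  exists (P : {poly K}) (z0 e beta : K) (a b : R),
  [/\ (2 < size P)%N, e != 0 & a < b] /\
  [/\ forall n, (forall w, v (w - z0) <= v e -> v (iter n (horner P) w) <= a) \/
      (forall w, v (w - z0) <= v e -> v (iter n (horner P) w) = b),
    forall n0 d, (0 < d)%N -> exists n, [/\ (n0 <= n)%N,
      forall w, v (w - z0) <= v e -> v (iter n (horner P) w) = b &
      forall w, v (w - z0) <= v e -> v (iter (n + d) (horner P) w) <= a],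
    forall e', v e < e' -> exists w n,
      [/\ v e < v (w - z0), v (w - z0) < e' & iter n (horner P) w = beta] &
    forall c N s C, iter N (horner P) c = beta -> 0 < s -> exists n,
      forall y, v y <= C ->
        exists2 z, iter n (horner P) z = y & v (z - c) <= s].
Proof.
move=> v_nt v_compl p_prime vp1.
have [k pE] : exists k, p = k.+1 by exists p.-1; rewrite prednK// prime_gt0.
subst p; have k0 : (0 < k)%N by have := prime_gt1 p_prime; rewrite ltnS.
(* The norm of [y] becomes L^4, so that |p| L^4 < 1. In characteristic p any |y| > 1 will do. *)
have [y [y1 yp]] : exists y, 1 < v y /\ v k.+1%:R * v y < 1.
  have [vp0|vp0] := eqVneq (v k.+1%:R) 0.
    have [y /andP[y1 _]] := unorm_dense v_nt (@ler01 R) (ltr1n R 2).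
    by exists y; rewrite y1 vp0 mul0r.
  have vp_gt0 : 0 < v k.+1%:R by rewrite lt_def vp0 unorm_ge0.
  have [|y /andP[y1 y2]] := unorm_dense v_nt (@ler01 R) (_ : 1 < (v k.+1%:R)^-1).
    by rewrite invf_gt1.
  by exists y; rewrite y1 mulrC -ltr_pdivlMr// mul1r.
have [|g gy] := @nth_root K y (k.+1 * (k * 4)); first by rewrite !muln_gt0 k0.
have g1 : 1 < v g.
  by move: y1; rewrite -gy unormX expr_gt1 ?unorm_ge0// !muln_gt0 k0.
pose beta := g ^+ k.+1.
pose b := (beta ^+ (3 * k))^-1.
pose c := (beta - beta ^+ k.+1 - b * beta) / beta ^+ (5 * k.+1).+1.
have vbeta : v beta = v g ^+ k.+1 by rewrite /beta unormX.
have beta_gt1 : 1 < v beta by rewrite vbeta exprn_egt1.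
have beta0 : beta != 0 by rewrite -(unorm_gt0 v) (lt_trans _ beta_gt1).
have vb : v b = ((v beta ^+ k) ^+ 3)^-1.
  by rewrite /b unormV -exprM mulnC -unormX.
have cE : c * beta ^+ (5 * k.+1).+1 = beta - beta ^+ k.+1 - b * beta.
  by rewrite /c divfK// expf_neq0.
have vp : v k.+1%:R * (v beta ^+ k) ^+ 4 < 1.
  by rewrite vbeta -!exprM -unormX gy.
have [t [tL itin]] := exists_parameter vbeta vb cE p_prime g1 vp v_compl.
have t_small : v t * v beta < v b.
  apply: parameter_small; eassumption.
pose z0 := (orbit_poly k beta b c (repel_time 0)).[t].
have itE n : iter n (horner (family k beta b c t)) z0 =
    (orbit_poly k beta b c (repel_time 0 + n)).[t].
  by rewrite orbit_poly_iter.
have timeE i : (repel_time 0 + (4 * i * i + 11 * i) = block_start i + repel_time i)%N.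
  by rewrite /repel_time /block_start; clear; lia.
have hA i j : (j < contract_time i)%N ->
    v (iter (4 * i * i + 11 * i + j) (horner (family k beta b c t)) z0) <= v g.
  move=> ji; rewrite itE addnA timeE; exact: (itin i).2.
have hB i j : (j < repel_time i.+1)%N ->
    v (iter (4 * i * i + 11 * i + contract_time i + j)
      (horner (family k beta b c t)) z0 - beta) < v beta.
  move=> ji; rewrite itE 2!addnA timeE -block_startS; exact: (itin i.+1).1.
exists (family k beta b c t), z0, (beta^-1 ^+ 2), beta, (v g), (v beta).
have ve : v (beta^-1 ^+ 2) = (v beta)^-1 ^+ 2 by rewrite unormX unormV.
rewrite ve; split; split.
- by apply: size_family; eassumption.
- by rewrite expf_neq0// invr_eq0.
- by rewrite vbeta -[ltLHS]expr1 ltr_eXn2l// ltnS.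
- by apply: disk_itinerary; eassumption.
- by apply: disk_itinerary_aperiodic; eassumption.
- by apply: beta_preimage_near_disk; eassumption.
- by apply: beta_preimage_expanding; eassumption.
Qed.

(** * The Berkovich line *)

Section Seminorm.
Context {R : realType} {K : closedFieldType} {v : ultrametric_norm R K}.
Implicit Types (x y : berk_line v) (f g : {poly K}) (a c z : K).

Lemma berk_eq x y : (forall f, x f = y f) -> x = y.
Proof.
case: x y => [x x1 x2 x3 x4] [y y1 y2 y3 y4] /= /funext xy; subst y.
by congr BerkLine; exact: Prop_irrelevance.
Qed.

Lemma seminorm0 x : x 0 = 0.
Proof. by rewrite -[0]polyC0 seminormC unorm0. Qed.

Lemma seminorm1 x : x 1 = 1.
Proof. by rewrite -[1]polyC1 seminormC unorm1. Qed.

Lemma seminormN x f : x (- f) = x f.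
Proof. by rewrite -mulN1r -polyC1 -polyCN seminormM seminormC unormN unorm1 mul1r. Qed.

Lemma seminormX x f n : x (f ^+ n) = x f ^+ n.
Proof. by elim: n => [|n IH]; rewrite ?expr0 ?seminorm1// !exprS seminormM IH. Qed.

Lemma seminormMn_le x f n : x (f *+ n) <= x f.
Proof.
rewrite -mulr_natl -polyC_natr seminormM seminormC.
by rewrite ler_piMl ?seminorm_ge0 ?unorm_nat.
Qed.

Lemma seminorm_sum x (I : Type) (s : seq I) (F : I -> {poly K}) :
  x (\sum_(i <- s) F i) <= \sum_(i <- s) x (F i).
Proof.
elim/big_ind2: _ => [|f a g b fa gb|//]; first by rewrite seminorm0.
by rewrite (le_trans (seminormD _ _ _))// lerD.
Qed.

Lemma seminorm_prod x (s : seq K) :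
  x (\prod_(i <- s) ('X - i%:P)) = \prod_(i <- s) x ('X - i%:P).
Proof.
by elim: s => [|i s IH]; rewrite ?big_nil ?seminorm1// !big_cons seminormM IH.
Qed.

(* Powers of [f + g] have only [n + 1] terms with integral coefficients, so the
   triangle inequality improves to the ultrametric one. *)
Lemma seminormU x f g : x (f + g) <= Num.max (x f) (x g).
Proof.
set M := Num.max _ _.
have M0 : 0 <= M by rewrite le_max seminorm_ge0.
have powM n : x (f + g) ^+ n <= n.+1%:R * M ^+ n.
  rewrite -seminormX exprDn (le_trans (seminorm_sum _ _ _))//.
  rewrite (@le_trans _ _ (\sum_(i < n.+1) M ^+ n))//; last first.
    by rewrite sumr_const card_ord mulr_natl.
  apply: ler_sum => i _; apply: (le_trans (seminormMn_le _ _ _)).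
  have i_le : (i <= n)%N by rewrite -ltnS.
  rewrite seminormM !seminormX -[in leRHS](subnK i_le) exprD.
  by rewrite ler_pM ?exprn_ge0 ?seminorm_ge0// lerXn2r ?nnegrE ?seminorm_ge0//
    le_max lexx ?orbT.
rewrite leNgt; apply/negP => Mlt.
have M_gt0 : 0 < M.
  rewrite lt_def M0 andbT; apply: contraTneq Mlt => M00; move: (powM 1%N).
  by rewrite M00 !expr1 mulr0 -leNgt.
pose d := x (f + g) / M - 1.
have d0 : 0 < d by rewrite subr_gt0 ltr_pdivlMr// mul1r.
have powd n : (1 + d) ^+ n <= n.+1%:R.
  have -> : 1 + d = x (f + g) / M by rewrite /d; ring.
  by rewrite exprMn exprVn ler_pdivrMr ?exprn_gt0.
clearbody d.
have bern n : 1 + n%:R * d <= (1 + d) ^+ n.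
  elim: n => [|n IH]; first by rewrite mul0r addr0 expr0.
  rewrite exprS -natr1; have : 0 <= n%:R * d by apply: mulr_ge0 => //; exact: ltW.
  by move: IH d0; move: ((1 + d) ^+ n) (n%:R : R) => A B; nra.
have [n nd] : exists n : nat, 3 / d ^+ 2 < n%:R.
  by exists (Num.truncn (3 / d ^+ 2)).+1; rewrite truncnS_gt.
have n1 : (1 <= n%:R :> R).
  case: n nd => [|n] nd; last by rewrite ler1n.
  by move: nd; rewrite ltNge divr_ge0// exprn_ge0// ltW.
move: nd; rewrite ltr_pdivrMr ?exprn_gt0// => nd.
(* Squaring Bernoulli's inequality gives (1 + n d)^2 <= (1 + d)^(2n) <= 2n + 1, which fails once n
   d^2 > 3. *)
have := powd (2 * n)%N; rewrite mulnC exprM -natr1 natrM.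
have := bern n; move: ((1 + d) ^+ n) (n%:R : R) nd n1 => A B nd n1 AB.
have : (1 + B * d) ^+ 2 <= A ^+ 2.
  by rewrite lerXn2r ?nnegrE// ?addr_ge0// ?mulr_ge0//; nra.
by move: nd n1 d0; rewrite !expr2; nra.
Qed.

Lemma seminormB_le x a c :
  x ('X - a%:P) <= Num.max (x ('X - c%:P)) (v (c - a)).
Proof.
have -> : 'X - a%:P = ('X - c%:P) + (c - a)%:P by rewrite polyCB addrA subrK.
by rewrite -(seminormC x) seminormU.
Qed.

Lemma seminormB_lt x a c : v (c - a) < x ('X - c%:P) ->
  x ('X - a%:P) = x ('X - c%:P).
Proof.
move=> ca; apply/eqP; rewrite eq_le; apply/andP; split.
  by rewrite (le_trans (seminormB_le _ _ c))// ge_max lexx ltW.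
have := seminormB_le x c a; rewrite le_max unormBC.
by rewrite (leNgt _ (v _)) ca orbF.
Qed.

Lemma seminormB_gt x a c : x ('X - c%:P) < v (c - a) ->
  x ('X - a%:P) = v (c - a).
Proof.
move=> ca; apply/eqP; rewrite eq_le; apply/andP; split.
  by rewrite (le_trans (seminormB_le _ _ c))// ge_max lexx ltW.
have : v (c - a) <= Num.max (x ('X - c%:P)) (x ('X - a%:P)).
  have -> : v (c - a) = x (('X - a%:P) - ('X - c%:P)).
    by rewrite -(seminormC x) polyCB; congr (x _); ring.
  by rewrite (le_trans (seminormU _ _ _))// seminormN maxC.
by rewrite le_max leNgt ca.
Qed.

(** Polynomials split, so equality and convergence of seminorms need to be tested on linear
    polynomials only. *)
Lemma seminorm_factor f : exists (l : K) (s : seq K),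
  forall x, x f = v l * \prod_(i <- s) x ('X - i%:P).
Proof.
have [s fE] := closed_field_poly_normal f.
exists (lead_coef f), s => x.
by rewrite {1}fE -mul_polyC seminormM seminormC seminorm_prod.
Qed.

Lemma berk_eq_linear x y : (forall a, x ('X - a%:P) = y ('X - a%:P)) -> x = y.
Proof.
move=> xy; apply: berk_eq => f; have [l [s fE]] := seminorm_factor f.
by rewrite !fE; congr (_ * _); apply: eq_bigr => i _.
Qed.

Lemma berk_evalE z f : berk_eval v z f = v f.[z].
Proof. by []. Qed.

Lemma berk_eval_linear z a : berk_eval v z ('X - a%:P) = v (z - a).
Proof. by rewrite berk_evalE !hornerE. Qed.

Lemma seminorm_le_coef x f :
  x f <= \sum_(i < size f) v f`_i * x 'X ^+ i.
Proof.
rewrite -{1}[f]coefK poly_def (le_trans (seminorm_sum _ _ _))//.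
by apply: ler_sum => i _; rewrite -mul_polyC seminormM seminormC seminormX.
Qed.

End Seminorm.

(** * Topology of the Berkovich line: separation, continuity and compact disks *)

Section Topology.
Context {R : realType} {K : closedFieldType} {v : ultrametric_norm R K}.
Implicit Types (x y : berk_line v) (f g : {poly K}) (a c z : K).

Lemma seminorm_continuous f : continuous (fun x : berk_line v => x f).
Proof.
move=> x; pose i := fun x : berk_line v => (x : {ptws {poly K} -> R}).
have ci : i @ x --> i x by apply: (@initial_continuous _ _ i).
exact: (cvg_comp _ _ ci (@proj_continuous _ (fun=> R) f (i x))).
Qed.

Lemma berk_cvgP {T : Type} (F : set_system T) {FF : Filter F} (g : T -> berk_line v) x :
  (forall f, g u f @[u --> F] --> x f) -> g @ F --> x.
Proof.
move=> gf; pose i := fun x : berk_line v => (x : {ptws {poly K} -> R}).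
have ci : (i \o g) @ F --> (i x : {ptws {poly K} -> R}).
  apply/cvg_sup => f A [B [[C oC <-] Cx] CA].
  by apply: filterS CA _; apply: gf; exact: open_nbhs_nbhs.
move=> A [B [[C oC <-] Cx] CA].
by apply: filterS CA _; apply: ci; exact: open_nbhs_nbhs.
Qed.

Lemma cvg_seminorm {T : Type} (F : set_system T) {FF : Filter F}
    (g : T -> berk_line v) (l : K -> R) f :
  (forall a, g u ('X - a%:P) @[u --> F] --> l a) ->
  cvg (g u f @[u --> F]).
Proof.
move=> gl; have [b [s fE]] := @seminorm_factor R K v f.
under eq_fun do rewrite fE.
apply: is_cvgM; first exact: is_cvg_cst.
elim: s {fE} => [|i s IH].
  by under eq_fun do rewrite big_nil; exact: is_cvg_cst.
under eq_fun do rewrite big_cons.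
by apply: is_cvgM => //; apply/cvg_ex; exists (l i); exact: gl.
Qed.

Lemma berk_cvg_linear {T : Type} (F : set_system T) {FF : Filter F}
    (g : T -> berk_line v) x :
  (forall a, g u ('X - a%:P) @[u --> F] --> x ('X - a%:P)) -> g @ F --> x.
Proof.
move=> gl; apply: berk_cvgP => f; have [b [s fE]] := @seminorm_factor R K v f.
under eq_fun do rewrite fE.
rewrite fE; apply: cvgM; first exact: cvg_cst.
elim: s {fE} => [|i s IH].
  by rewrite big_nil; under eq_fun do rewrite big_nil; exact: cvg_cst.
rewrite big_cons; under eq_fun do rewrite big_cons.
exact: cvgM.
Qed.

Lemma berk_lim {T : Type} (F : set_system T) {FF : ProperFilter F}
    (g : T -> berk_line v) :
  (forall f, cvg (g u f @[u --> F])) ->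
  exists x, forall f, g u f @[u --> F] --> x f.
Proof.
move=> gcvg; pose l f := lim (g u f @[u --> F]).
have gl f : g u f @[u --> F] --> l f := gcvg f.
have l1 f : 0 <= l f.
  by apply: (cvgr_to_ge (gl f)); apply: nearW => u; exact: seminorm_ge0.
have l2 c : l c%:P = v c.
  by apply/cvg_lim => //; under eq_fun do rewrite seminormC; exact: cvg_cst.
have l3 f h : l (f * h) = l f * l h.
  apply/cvg_lim => //; under eq_fun do rewrite seminormM; exact: cvgM.
have l4 f h : l (f + h) <= l f + l h.
  have fh : g u f + g u h @[u --> F] --> l f + l h by exact: cvgD.
  rewrite -subr_ge0; apply: (cvgr_to_ge (cvgB fh (gl (f + h)))).
  by apply: nearW => u /=; rewrite subr_ge0; exact: seminormD.
by exists (BerkLine l1 l2 l3 l4).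
Qed.

Lemma berk_hausdorff : hausdorff_space (berk_line v).
Proof.
move=> x y xy; apply: berk_eq => f.
apply: (@Rhausdorff R) => A B Ax By.
have [z [Az Bz]] := xy _ _ (seminorm_continuous Ax) (seminorm_continuous By).
by exists (z f).
Qed.

Lemma berk_push_continuous P : continuous (@berk_push R K v P).
Proof.
move=> x; apply: (@berk_cvgP _ (nbhs x) (nbhs_filter x)) => f.
exact: (@seminorm_continuous (f \Po P) x). Qed.

Lemma closed_berk_disk c s : closed [set x : berk_line v | x ('X - c%:P) <= s].
Proof.
apply: (@closed_comp _ _ (fun x : berk_line v => x ('X - c%:P)) [set r | r <= s]).
  by move=> x _; exact: seminorm_continuous.
exact: closed_le.
Qed.

Lemma open_berk_disk c s : open [set x : berk_line v | x ('X - c%:P) < s].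
Proof.
apply: (@open_comp _ _ (fun x : berk_line v => x ('X - c%:P)) [set r | r < s]).
  by move=> x _; exact: seminorm_continuous.
exact: open_lt.
Qed.

(** Each [f] is bounded on the disk through its coefficients, so its values converge along every
    ultrafilter, and the limits form a seminorm. *)
Lemma compact_berk_disk c s : compact [set x : berk_line v | x ('X - c%:P) <= s].
Proof.
set A := [set x | _]; rewrite compact_ultra => F FU FA.
have FP : ProperFilter F by exact: ultra_proper.
have bound f : exists M, forall x, A x -> x f <= M.
  exists (\sum_(i < size f) v f`_i * (s + v c) ^+ i) => x Ax.
  rewrite (le_trans (seminorm_le_coef _ _))// ler_sum// => i _.
  rewrite ler_wpM2l ?unorm_ge0// lerXn2r ?nnegrE ?seminorm_ge0//.
    by rewrite addr_ge0 ?unorm_ge0// (le_trans (seminorm_ge0 _ _) Ax).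
  rewrite -[X in x X](subrK c%:P) (le_trans (seminormD _ _ _))// lerD//.
  by rewrite seminormC.
have [f|x gx] := @berk_lim _ F _ id.
  have [M AM] := bound f.
  have FM : F ((fun x : berk_line v => x f) @^-1` `[0, M]).
    by apply: filterS FA => x Ax; rewrite /= in_itv/= seminorm_ge0 AM.
  have [p [_ clp]] := @segment_compact R 0 M (x f @[x --> F]) _ FM.
  apply/cvg_ex; exists p => N Np.
  have [//|FN] := in_ultra_setVsetC ((fun x : berk_line v => x f) @^-1` N) FU.
  by have [y []] := clp (~` N) N FN Np.
exists x; split; last exact: berk_cvgP.
by apply: (closed_cvg _ (@closed_berk_disk c s) _ _ (berk_cvgP gx)).
Qed.

End Topology.

(** * Density of the points of [K], Gauss points and connectedness of disks *)

Section Density.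
Context {R : realType} {K : closedFieldType} {v : ultrametric_norm R K}.
Hypothesis v_nt : nontrivial_norm v.
Implicit Types (x y : berk_line v) (f g : {poly K}) (a c z : K).

(** Let [c0] in [s] minimize x(X - c), with minimum rho. A point whose distance to [c0] is slightly
    above rho, and below the next value, is as far from every c attaining the minimum, and at
    distance |c0 - c| = x(X - c) from the others. *)
Lemma approx_seminorm x (s : seq K) (e : R) : 0 < e ->
  exists z, forall c, c \in s -> `|x ('X - c%:P) - v (z - c)| < e.
Proof.
move=> e0; case: s => [|c0' s']; first by exists 0.
set s := c0' :: s'.
have [c0 c0s c0min] : exists2 c0, c0 \in s &
    forall c, c \in s -> x ('X - c0%:P) <= x ('X - c%:P).
  rewrite {}/s; elim: s' c0' => [|d s IH] c.
    by exists c; rewrite ?mem_head// => c'; rewrite inE => /eqP ->.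
  have [c1 c1s c1min] := IH d.
  have [le1|/ltW le1] := leP (x ('X - c%:P)) (x ('X - c1%:P)).
    exists c; rewrite ?mem_head// => c'; rewrite inE => /predU1P[->//|c's].
    by rewrite (le_trans le1)// c1min.
  exists c1; first by rewrite inE c1s orbT.
  by move=> c'; rewrite inE => /predU1P[->//|/c1min].
set rho := x ('X - c0%:P) in c0min *.
have [M rhoM MP] : exists2 M, rho < M &
    forall c, c \in s -> rho < x ('X - c%:P) -> M <= x ('X - c%:P).
  elim: {c0s c0min} s => [|c s [M rhoM MP]]; first by exists (rho + 1); rewrite ?ltrDl.
  have [c_rho|c_rho] := ltP rho (x ('X - c%:P)).
    exists (Num.min M (x ('X - c%:P))); first by rewrite lt_min rhoM.
    move=> c'; rewrite inE => /predU1P[-> _|c's /(MP _ c's) h].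
      by rewrite ge_min lexx orbT.
    by rewrite ge_min h.
  exists M => // c'; rewrite inE => /predU1P[->|/MP//].
  by rewrite ltNge c_rho.
have [|z' /andP[rz]] := unorm_dense v_nt (seminorm_ge0 x ('X - c0%:P))
    (_ : rho < Num.min M (rho + e)).
  by rewrite lt_min rhoM ltrDl.
rewrite lt_min -/rho in rz * => /andP[zM ze].
exists (c0 + z') => c cs; have := c0min _ cs; rewrite le_eqVlt => /predU1P[cE|c_rho].
  have cc0 : v (c0 - c) <= rho.
    have -> : v (c0 - c) = x (('X - c%:P) - ('X - c0%:P)).
      by rewrite -(seminormC x) polyCB; congr (x _); ring.
    by rewrite (le_trans (seminormU _ _ _))// seminormN -cE maxxx.
  have -> : v (c0 + z' - c) = v z'.
    have -> : c0 + z' - c = z' + (c0 - c) by ring.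
    by rewrite unormDr// (le_lt_trans cc0).
  by rewrite -cE distrC gtr0_norm ?subr_gt0// ltrBlDl.
have cc0 : x ('X - c%:P) = v (c0 - c).
  apply: seminormB_gt; rewrite ltNge; apply/negP => cc0.
  have := seminormB_le x c c0; rewrite -/rho (max_l cc0).
  by rewrite leNgt c_rho.
have -> : v (c0 + z' - c) = v (c0 - c).
  have -> : c0 + z' - c = z' + (c0 - c) by ring.
  by rewrite unormDl// -cc0 (lt_le_trans zM)// MP.
by rewrite cc0 subrr normr0.
Qed.

Lemma berk_eval_dense x U : nbhs x U -> exists z, U (berk_eval v z).
Proof.
move=> xU; pose W (p : seq K * R) :=
  [set z : K | forall c, c \in p.1 -> `|x ('X - c%:P) - v (z - c)| < p.2].
pose F := filter_from [set p : seq K * R | 0 < p.2] W.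
have FF : ProperFilter F.
  apply: filter_from_proper; last by move=> [s e] /= e0; exact: approx_seminorm.
  apply: filter_from_filter; first by exists ([::], 1) => /=.
  move=> [s e] [s' e'] /= e0 e'0; exists (s ++ s', Num.min e e').
    by rewrite /= lt_min e0.
  move=> z /= h; split=> c cs; have := h c; rewrite mem_cat cs ?orbT => /(_ isT).
    by rewrite lt_min => /andP[].
  by rewrite lt_min => /andP[].
have cvgF : berk_eval v @ F --> x.
  apply: berk_cvg_linear => a; apply/cvgrPdist_lt => e e0.
  exists ([:: a], e) => // z h.
  change (`|x ('X - a%:P) - berk_eval v z ('X - a%:P)| < e).
  by rewrite berk_eval_linear; apply: h; rewrite mem_head.
have FU : F (berk_eval v @^-1` U) := cvgF _ xU.
by have [z Uz] := filter_ex FU; exists z.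
Qed.

Lemma berk_eval_dense_disk x U c r : nbhs x U -> x ('X - c%:P) < r ->
  exists2 z, U (berk_eval v z) & v (z - c) < r.
Proof.
move=> xU xr; have : nbhs x (U `&` [set y : berk_line v | y ('X - c%:P) < r]).
  apply: filterI => //; apply: open_nbhs_nbhs; split => //.
  exact: open_berk_disk.
move=> /berk_eval_dense[z [Uz zr]]; exists z => //.
by rewrite -berk_eval_linear.
Qed.

Lemma seminorm_closed x c r f (A : set R) : x ('X - c%:P) < r -> closed A ->
  (forall z, v (z - c) < r -> A (v f.[z])) -> A (x f).
Proof.
move=> xr cA Af; apply: contrapT => nA.
have nxA : nbhs x [set y : berk_line v | ~ A (y f)].
  have nA' : nbhs (x f) (~` A) by apply: open_nbhs_nbhs; split=> //; exact: closed_openC.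
  exact: (@seminorm_continuous R K v f x _ nA').
have [z nz zr] := berk_eval_dense_disk nxA xr.
exact: nz (Af _ zr).
Qed.

Lemma cvg_unorm_shrink (z_ : nat -> K) c s :
  (forall n, s < v (z_ n - c) < s + n.+1%:R^-1) ->
  forall a, v (z_ n - a) @[n --> \oo] --> Num.max s (v (c - a)).
Proof.
move=> zs a.
have zc : v (z_ n - c) @[n --> \oo] --> s.
  apply/cvgrPdist_lt => e e0.
  near=> n; have /andP[h1 h2] := zs n.
  rewrite distrC gtr0_norm ?subr_gt0// ltrBlDl (lt_trans h2)// ltrD2l.
  by near: n; exact: near_infty_natSinv_lt (PosNum e0).
have [sa|sa] := leP (v (c - a)) s.
  suff -> : (fun n => v (z_ n - a)) = (fun n => v (z_ n - c)) by [].
  apply/funext => n; have -> : z_ n - a = (z_ n - c) + (c - a) by ring.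
  by rewrite unormDr// (le_lt_trans sa)//; case/andP: (zs n).
apply/cvgrPdist_lt => e e0; near=> n.
have zn : v (z_ n - c) < v (c - a) by near: n; exact: (cvgr_lt _ zc).
have -> : z_ n - a = (z_ n - c) + (c - a) by ring.
by rewrite [v (_ + (c - a))]unormDl// subrr normr0.
Unshelve. all: by end_near. Qed.

(* The point is obtained as the limit of points of [K] whose distance to [c]
   decreases to [s]; this avoids proving that Gauss norms are multiplicative. *)
Lemma exists_gauss_point c s : 0 <= s ->
  exists x, forall a, x ('X - a%:P) = Num.max s (v (c - a)).
Proof.
move=> s0.
have /choice[z zP] : forall n : nat, exists z, s < v (z - c) < s + n.+1%:R^-1.
  move=> n; have [|z zP] := unorm_dense v_nt s0 (_ : s < s + n.+1%:R^-1).
    by rewrite ltrDl invr_gt0.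
  by exists (c + z); rewrite addrAC subrr add0r.
have cz := cvg_unorm_shrink zP.
have czl a : berk_eval v (z n) ('X - a%:P) @[n --> \oo] --> Num.max s (v (c - a)).
  by under eq_fun do rewrite berk_eval_linear; exact: cz.
have [f|x xP] := @berk_lim _ _ v _ (\oo) _ (fun n => berk_eval v (z n)).
  exact: (@cvg_seminorm _ _ _ _ \oo _ (fun n => berk_eval v (z n)) _ f czl).
exists x => a; exact: (cvg_unique (@Rhausdorff R) (xP ('X - a%:P)) (czl a)).
Qed.

(* The Gauss points of the disks around a given [u] form a ray, any two rays
   meet, and their union contains the dense set of points of [K]. *)
Lemma berk_disk_connected c r : connected [set x : berk_line v | x ('X - c%:P) < r].
Proof.
have /choice[path pathP] : forall us : K * R, exists x : berk_line v,
    forall a, x ('X - a%:P) = Num.max `|us.2| (v (us.1 - a)).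
  by move=> [u s]; exact: exists_gauss_point.
have path_cont u : continuous (fun s => path (u, s)).
  move=> s; apply: (@berk_cvg_linear _ _ _ _ (nbhs s) (nbhs_filter s)) => a.
  under eq_fun do rewrite pathP/= maxr_absE.
  rewrite pathP/= maxr_absE; apply: cvgM; last exact: cvg_cst.
  have cs : `|t| @[t --> s] --> `|s| by exact: cvg_norm.
  apply: cvgD; first by apply: cvgD => //; exact: cvg_cst.
  by apply: cvg_norm; apply: cvgB => //; exact: cvg_cst.
set D := [set x | _].
have [r0|r0] := leP r 0.
  suff -> : D = set0 by exact: connected0.
  rewrite -subset0 => x /= /lt_le_trans/(_ r0).
  by rewrite ltNge seminorm_ge0.
pose ray u := (fun s => path (u, s)) @` `[0, r[.
have ray_conn u : connected (ray u).
  apply: connected_continuous_connected.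
    by apply/connected_intervalP; exact: interval_is_interval.
  exact: continuous_subspaceT.
have path0 u : path (u, 0) = berk_eval v u.
  by apply: berk_eq_linear => a; rewrite berk_eval_linear pathP/= normr0 max_r// unorm_ge0.
have ray0 u : ray u (path (u, 0)).
  by exists 0 => //=; rewrite in_itv/= lexx.
pose E := \bigcup_(u in [set u | v (u - c) < r]) (ray u `|` ray c).
have E_conn : connected E.
  apply: bigcup_connected.
    by exists (path (c, 0)) => u _; right; exact: ray0.
  move=> u uc; apply: connectedU => //.
  (* The disks of radius |u - c| around [u] and [c] coincide, so both rays pass through their Gauss
     point. *)
  exists (path (u, v (u - c))); split.
    by exists (v (u - c)) => //=; rewrite in_itv/= unorm_ge0.
  exists (v (u - c)); first by rewrite /= in_itv/= unorm_ge0.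
  apply: berk_eq_linear => a; rewrite !pathP/= ger0_norm ?unorm_ge0//.
  apply/eqP; rewrite eq_le !ge_max !le_max !lexx/= -!le_max.
  have uE : u - a = (u - c) + (c - a) by rewrite addrA subrK.
  have cE : c - a = (c - u) + (u - a) by rewrite addrA subrK.
  rewrite {1}cE [v (u - c)]unormBC unormD/= {1}uE (le_trans (unormD _ _ _))//.
  by rewrite [v (u - c)]unormBC.
have ED : E `<=` D.
  have rayD u : v (u - c) < r -> ray u `<=` D.
    move=> uc x [s /=]; rewrite in_itv/= => /andP[s0 sr] <-; rewrite /D/= pathP/=.
    by rewrite ger0_norm// gt_max sr.
  move=> x [u /= uc [|]]; first exact: rayD.
  by apply: rayD; rewrite subrr unorm0.
have DE : D `<=` closure E.
  move=> x Dx U /(berk_eval_dense_disk)/(_ Dx)[z Uz zr].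
  exists (berk_eval v z); split=> //; exists z => //; left.
  by rewrite -path0; exact: ray0.
(* Connectedness passes from [E] to [D], which lies in the closure of [E]: a nonempty clopen part of
   [D] meets [E], hence contains [E], hence [D]. *)
move=> B [x Bx] [V oV BV] [C cC BC].
have EB : E `&` B = E.
  apply: E_conn.
  - have [Dx Vx] : D x /\ V x by rewrite BV in Bx; case: Bx.
    have [y [Ey Vy]] := DE _ Dx _ (open_nbhs_nbhs (conj oV Vx)).
    by exists y; split => //; rewrite BV; split => //; exact: ED.
  - by exists V => //; rewrite BV setIA (setIidl ED).
  - by exists C => //; rewrite BC setIA (setIidl ED).
rewrite BC; apply/setIidl => y /DE.
rewrite (closure_id C).1//; apply: closureS => z Ez.
have [_ ] : (E `&` B) z by rewrite EB.
by rewrite BC => -[].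
Qed.

End Density.

(** * Fatou components *)

Section Action.
Context {R : realType} {K : closedFieldType} {v : ultrametric_norm R K}.
Variable P : {poly K}.
Implicit Types (x y : berk_line v) (f : {poly K}) (z : K).

Lemma iter_berk_push n x f :
  iter n (berk_push P) x f = x (f \Po poly_iter P n).
Proof.
elim: n f => [|n IH] f; first by rewrite comp_polyXr.
by rewrite iterS /= IH comp_polyA.
Qed.

Lemma iter_berk_push_eval n z :
  iter n (berk_push P) (berk_eval v z) = berk_eval v (iter n (horner P) z).
Proof.
apply: berk_eq => f; rewrite iter_berk_push !berk_evalE horner_comp.
by rewrite horner_poly_iter.
Qed.

Lemma iter_poly_act_some n x :
  iter n (@poly_act R K v P) (Some x) = Some (iter n (berk_push P) x).
Proof. by elim: n => [//|n IH]; rewrite !iterS IH. Qed.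

Lemma iter_berk_push_continuous n :
  continuous (iter n (@berk_push R K v P)).
Proof.
elim: n => [|n IH] x; first exact: cvg_id.
apply: (@continuous_comp _ _ _ (iter n (berk_push P)) (berk_push P)).
  exact: IH.
exact: berk_push_continuous.
Qed.

End Action.

(** * Preimages of beta in the Julia set and the boundary of the disk *)

Section Julia.
Context {R : realType} {K : closedFieldType} {v : ultrametric_norm R K}.
Hypothesis v_nt : nontrivial_norm v.
Variables (P : {poly K}) (beta : K).
Implicit Types (x y : berk_line v) (f : {poly K}) (a c z : K).

Hypothesis beta_expanding : forall c N (s C : R), iter N (horner P) c = beta -> 0 < s ->
  exists n, forall w, v w <= C ->
    exists2 z, iter n (horner P) z = w & v (z - c) <= s.

(** On a disk around [c] of radius below |c - a| the seminorm of X - a is constant, so small disks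
    form a neighborhood basis. *)
Lemma berk_eval_nbhs c A : nbhs (berk_eval v c) A ->
  exists2 s, 0 < s & [set x : berk_line v | x ('X - c%:P) <= s] `<=` A.
Proof.
pose F := filter_from [set s : R | 0 < s]
  (fun s => [set x : berk_line v | x ('X - c%:P) <= s]).
have FF : Filter F.
  apply: filter_from_filter; first by exists 1 => /=.
  move=> s s' /= s0 s'0; exists (Num.min s s'); first by rewrite /= lt_min s0.
  by move=> x /=; rewrite le_min => /andP.
suff cvgF : id @ F --> berk_eval v c.
  by move=> /cvgF[s s0 sA]; exists s.
apply: berk_cvg_linear => a; rewrite berk_eval_linear.
apply/cvgrPdist_le => e e0.
have [<-|ca] := eqVneq c a.
  exists e => // x /= xe; rewrite subrr unorm0 sub0r normrN ger0_norm//.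
  exact: seminorm_ge0.
have ca0 : 0 < v (c - a) by rewrite unorm_gt0 subr_eq0.
exists (v (c - a) / 2); first by rewrite /= divr_gt0.
move=> x /= xs; rewrite (@seminormB_gt _ _ _ x a c) ?subrr ?normr0 ?ltW//.
by rewrite (le_lt_trans xs)// ltr_pdivrMr// ltr_pMr// ltr1n.
Qed.

(* A small disk around [c] is spread over arbitrarily large disks of [K] by the
   iterates of [P]; compactness of its images then yields all of the affine
   line, since the points of [K] are dense. *)
Lemma beta_preimage_julia c N : iter N (horner P) c = beta ->
  ~ fatou_set (@poly_act R K v P) (Some (berk_eval v c)).
Proof.
move=> cb [U [oU Uc]]; apply.
apply: (@sub_finite_set _ _ [set None]); last exact: finite_set1.
move=> [y|//] nUy; exfalso; apply: nUy.
have nU : nbhs (berk_eval v c) (Some @^-1` U).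
  by have := open_nbhs_nbhs (conj oU Uc).
have [s s0 sU] := berk_eval_nbhs nU.
set E := [set x | _] in sU.
(* The bound y(X) + 1 leaves room for the points of [K] close to [y]. *)
have [n nE] := beta_expanding (y 'X + 1) cb s0.
have cE : closed (iter n (berk_push P) @` E).
  apply: compact_closed; first exact: berk_hausdorff.
  apply: continuous_compact; last exact: compact_berk_disk.
  exact/continuous_subspaceT/iter_berk_push_continuous.
have : (iter n (berk_push P) @` E) y.
  rewrite ((closure_id _).1 cE) => A yA.
  have y0 : y ('X - 0%:P) < y 'X + 1 by rewrite subr0 ltrDl.
  have [w Aw] := berk_eval_dense_disk v_nt yA y0.
  rewrite subr0 => /ltW/nE[z zw zc]; exists (berk_eval v w); split => //.
  rewrite -(berk_eval_linear (v := v)) in zc; exists (berk_eval v z) => //.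
  by rewrite iter_berk_push_eval zw.
move=> [x Ex xy]; exists n => //; exists (Some x); first exact: sU.
by rewrite iter_poly_act_some xy.
Qed.

Section Boundary.
Variables (z0 : K) (r : R).
Hypothesis r_gt0 : 0 < r.
Hypothesis preimages : forall e, r < e -> exists w n,
  [/\ r < v (w - z0), v (w - z0) < e & iter n (horner P) w = beta].

Let D := [set x : berk_line v | x ('X - z0%:P) < r].

Lemma open_fatou_set : open (fatou_set (@poly_act R K v P)).
Proof.
rewrite openE => x [U [oU Ux Uinf]]; rewrite /interior nbhsE.
by exists U => // y Uy; exists U.
Qed.

(* A boundary point of [D] has to be the Gauss point of the disk of radius [r],
   which is a limit of preimages of [beta]. *)
Lemma closure_disk_fatou x : closure D x ->
  fatou_set (@poly_act R K v P) (Some x) -> D x.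
Proof.
move=> Dx Fx; apply: contrapT => /negP; rewrite -leNgt => rx.
have cl A f : closed A -> (forall y, D y -> A (y f)) -> A (x f).
  move=> cA DA; have : closed [set y : berk_line v | A (y f)].
    apply: (@closed_comp _ _ (fun y : berk_line v => y f)) => // y _.
    exact: seminorm_continuous.
  by apply; apply: closureS Dx.
have xr : x ('X - z0%:P) = r.
  apply/eqP; rewrite eq_le rx andbT.
  by apply: (cl [set s | s <= r]); [exact: closed_le|move=> y /ltW].
have xa a : x ('X - a%:P) = Num.max r (v (z0 - a)).
  have [ra|ar] := leP r (v (z0 - a)); last by rewrite (@seminormB_lt _ _ _ x a z0) xr.
  apply: (cl [set s | s = v (z0 - a)]); first exact: closed_eq.
  by move=> y Dy; rewrite /= (@seminormB_gt _ _ _ y a z0)// (lt_le_trans Dy).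
have /choice[c cP] : forall n : nat, exists c, r < v (c - z0) < r + n.+1%:R^-1 /\
    exists N, iter N (horner P) c = beta.
  move=> n; have [|w [N [h1 h2 h3]]] := preimages (_ : r < r + n.+1%:R^-1).
    by rewrite ltrDl invr_gt0.
  by exists w; rewrite h1 h2; split => //; exists N.
have cz := @cvg_unorm_shrink R K v c z0 r (fun n => (cP n).1).
have cx : (fun n => berk_eval v (c n)) @ \oo --> x.
  apply: berk_cvg_linear => a; rewrite xa.
  by under eq_fun do rewrite berk_eval_linear; exact: cz.
have [n _ nF] : \forall n \near \oo,
    fatou_set (@poly_act R K v P) (Some (berk_eval v (c n))).
  have nF : nbhs x [set y | fatou_set (@poly_act R K v P) (Some y)].
    by have := open_nbhs_nbhs (conj open_fatou_set Fx).
  exact: cx nF.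
have [N cN] := (cP n).2.
exact: beta_preimage_julia cN (nF n (leqnn _)).
Qed.

(** The disk is open, connected and relatively closed in the Fatou set. *)
Lemma disk_fatou_component : Some @` D `<=` fatou_set (@poly_act R K v P) ->
  fatou_component (@poly_act R K v P) (Some @` D).
Proof.
move=> DF; set x0 : berk_proj_line v := Some (berk_eval v z0).
have Dx0 : (Some @` D) x0.
  have z00 : v (z0 - z0) < r by rewrite subrr unorm0.
  by rewrite -(berk_eval_linear (v := v)) in z00; exists (berk_eval v z0).
exists x0; first exact: DF.
have oD : open (Some @` D : set (berk_proj_line v)).
  by apply: one_point_compactification_open_some; exact: open_berk_disk.
have cD : connected (Some @` D : set (berk_proj_line v)).
  apply: connected_continuous_connected; first exact: berk_disk_connected.
  exact/continuous_subspaceT/one_point_compactification_some_continuous.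
apply/seteqP; split; first exact: connected_component_max.
move=> y [C [Cx0 CF cC] Cy].
suff CD : C `&` (Some @` D) = C by have [_ ] : (C `&` (Some @` D)) y by rewrite CD.
apply: cC; first by exists x0.
- by exists (Some @` D).
- exists (closure (Some @` D : set (berk_proj_line v))); first exact: closed_closure.
  apply/seteqP; split=> x [Cx]; first by move=> Dx; split=> //; exact: subset_closure.
  move=> clx; split=> //; case: x Cx clx => [x|] Cx clx.
    exists x => //; apply: closure_disk_fatou; last exact: CF.
    move=> A xA; have [_ [[w Dw <-] [w' Aw' [ww']]]] :=
      clx _ (one_point_compactification_some_nbhs _ _ xA).
    by exists w; split => //; rewrite -ww'.
  (* Infinity is not in the closure: the complement of the compact closed disk is a neighborhood of
     it. *)
  exfalso; pose E := [set x : berk_line v | x ('X - z0%:P) <= r].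
  have [|_ [[w Dw <-] []]] := clx (Some @` (~` E) `|` [set None]).
  + exists E => //; split; [exact: compact_berk_disk|exact: closed_berk_disk].
  + by move=> [w' Ew' [ww']]; apply: Ew'; rewrite ww' /E/= ltW.
  + by [].
Qed.

End Boundary.
End Julia.

(** * Disks with an aperiodic itinerary *)

Section Itinerary.
Context {R : realType} {K : closedFieldType} {v : ultrametric_norm R K}.
Hypothesis v_nt : nontrivial_norm v.
Variables (P : {poly K}) (z0 : K) (r a b : R).
Implicit Types (x y : berk_line v) (w z : K).

Hypothesis a_lt_b : a < b.
Hypothesis itinerary : forall n,
  (forall w, v (w - z0) < r -> v (iter n (horner P) w) <= a) \/
  (forall w, v (w - z0) < r -> v (iter n (horner P) w) = b).
Hypothesis aperiodic : forall n0 d, (0 < d)%N -> exists n, [/\ (n0 <= n)%N,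
  forall w, v (w - z0) < r -> v (iter n (horner P) w) = b &
  forall w, v (w - z0) < r -> v (iter (n + d) (horner P) w) <= a].

Let D := [set x : berk_line v | x ('X - z0%:P) < r].
Let F := @poly_act R K v P.
Let push n := iter n (@berk_push R K v P).

Let pushX n x : push n x 'X = x (poly_iter P n).
Proof. by rewrite /push iter_berk_push comp_polyX. Qed.

Let push_le n x : D x -> (forall w, v (w - z0) < r -> v (iter n (horner P) w) <= a) ->
  push n x 'X <= a.
Proof.
move=> Dx h; rewrite pushX.
apply: (@seminorm_closed R K v v_nt x z0 r _ [set s : R | s <= a]) => // w wr.
by rewrite /= horner_poly_iter h.
Qed.

Let push_eq n x : D x -> (forall w, v (w - z0) < r -> v (iter n (horner P) w) = b) ->
  push n x 'X = b.
Proof.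
move=> Dx h; rewrite pushX.
apply: (@seminorm_closed R K v v_nt x z0 r _ [set s : R | s = b]) => // w wr.
by rewrite /= horner_poly_iter h.
Qed.

Let push_le_b n x : D x -> push n x 'X <= b.
Proof.
move=> Dx; have [h|h] := itinerary n; last by rewrite push_eq.
by rewrite (le_trans (push_le Dx h))// ltW.
Qed.

(** All images of the disk stay in |z| <= b, so they omit the powers of any c with |c| > max(1,
    b). *)
Lemma disk_sub_fatou : Some @` D `<=` fatou_set F.
Proof.
move=> _ [x Dx <-]; exists (Some @` D); split; last 1 first.
- have [c c1] : exists c, Num.max 1 b < v c.
    have m0 : 0 <= Num.max 1 b by rewrite le_max ler01.
    have m1 : Num.max 1 b < Num.max 1 b + 1 by rewrite ltrDl.
    by have [c /andP[? _]] := unorm_dense v_nt m0 m1; exists c.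
  move: c1; rewrite gt_max => /andP[c1 cb].
  pose h n : berk_proj_line v := Some (berk_eval v (c ^+ n.+1)).
  have hinj : injective h.
    move=> i j /Some_inj/(congr1 (fun x : berk_line v => x 'X)).
    rewrite !berk_evalE !hornerX !unormX => E; apply: succn_inj.
    by apply: (ieexprIn _ _ E); rewrite ?gt_eqF// (lt_trans ltr01).
  move=> finC; apply: infinite_nat.
  apply: (@sub_finite_set _ _ (h @^-1` _) _ (finite_preimage (in2W hinj) finC)).
  move=> n _ [i _ [_ [y Dy <-]]].
  rewrite /F iter_poly_act_some => /Some_inj/(congr1 (fun x : berk_line v => x 'X)).
  rewrite berk_evalE hornerX unormX => E; have := push_le_b i Dy.
  rewrite /push E leNgt (lt_le_trans cb)// exprS ler_peMr ?unorm_ge0//.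
  by rewrite exprn_ege1// ltW.
- by apply: one_point_compactification_open_some; exact: open_berk_disk.
- by exists x.
Qed.

(** A common point of the images at times i < j would have, at a later time, both norm b and norm at
    most a, by aperiodicity with shift j - i. *)
Lemma disk_wandering : wandering F (Some @` D).
Proof.
have lt_disj i j : (i < j)%N ->
    (iter i F @` (Some @` D)) `&` (iter j F @` (Some @` D)) = set0.
  move=> ij; rewrite -subset0 => _ [[_ [x Dx <-] <-] [_ [y Dy <-]]].
  rewrite /F !iter_poly_act_some => /Some_inj.
  have ij0 : (0 < j - i)%N by rewrite subn_gt0.
  have [n [ni hb ha]] := aperiodic i ij0.
  move=> /(congr1 (push (n - i))); rewrite /push -!iterD subnK//.
  have -> : (n - i + j = n + (j - i))%N by move: ni ij; clear; lia.
  move=> /(congr1 (fun x : berk_line v => x 'X)) E.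
  have := push_le Dy ha; rewrite /push E.
  by have := push_eq Dx hb; rewrite /push => ->; rewrite leNgt a_lt_b.
move=> i j _ _ ij; apply/eqP; case: ltngtP => // lt_ij.
- by move: ij; rewrite lt_disj// => -[].
- by move: ij; rewrite setIC lt_disj// => -[].
Qed.

(** For an orbit asymptotic to one of period q, the norms along each residue class of times modulo q
    would converge; aperiodicity with shift q produces arbitrarily late jumps from b to at most a
    between consecutive terms. *)
Lemma disk_nontrivial : ~ trivial_wandering F (Some @` D).
Proof.
move=> [_ [x Dx <-] [y [q [q0 _ cvg_y]]]].
have cvg_val j : exists l : R, push (n * q + j) x 'X @[n --> \oo] --> l.
  have := cvg_y j; case: (iter j F y) => [z|] cz.
    exists (z 'X).
    have cz' : push (n * q + j) x @[n --> \oo] --> z.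
      move=> A zA; have [N _ NP] := cz _ (one_point_compactification_some_nbhs _ _ zA).
      exists N => // n /NP /=; rewrite /F iter_poly_act_some => -[w Aw /Some_inj ww].
      by rewrite /push -ww.
    exact: (cvg_comp _ _ cz' (@seminorm_continuous R K v 'X z)).
  (* The limit is not infinity, as the orbit stays in the compact disk of radius b. *)
  exfalso; pose E := [set x : berk_line v | x ('X - 0%:P) <= b].
  have /cz [n _ nE] : nbhs (None : berk_proj_line v) (Some @` (~` E) `|` [set None]).
    by exists E => //; split; [exact: compact_berk_disk|exact: closed_berk_disk].
  have := nE n (leqnn _); rewrite /= /F iter_poly_act_some => -[|//] [w Ew /Some_inj ww].
  by apply: Ew; rewrite ww /E/= subr0; exact: push_le_b.
have /choice[l lP] := cvg_val.
have d0 : 0 < (b - a) / 2 by rewrite divr_gt0// subr_gt0.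
have /choice[N NP] : forall j, exists N, forall n, (N <= n)%N ->
    `|l j - push (n * q + j) x 'X| < (b - a) / 2.
  move=> j; have /cvgrPdist_lt/(_ _ d0)[N _ NP] := lP j.
  by exists N => n; exact: NP.
(* The residue classes are finitely many, so one rank is late enough for all of them. *)
pose M := (\max_(j < q) N j)%N.
have [n [nM hb ha]] := aperiodic (M * q) q0.
pose j := Ordinal (ltn_pmod n q0).
have Nj : (N j <= n %/ q)%N.
  by rewrite leq_divRL// (leq_trans _ nM)// leq_mul2r (leq_bigmax j) orbT.
have := NP j (n %/ q)%N Nj; have := NP j (n %/ q).+1%N (leqW Nj).
rewrite /= mulSn -addnA -divn_eq addnC (push_eq Dx hb).
have := push_le Dx ha; move: (push _ x 'X) (l _) => A B Aa.
rewrite !ltr_norml; lra.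
Qed.

End Itinerary.

Theorem theorem2 (R : realType) (K : closedFieldType)
    (v : ultrametric_norm R K) :
  nontrivial_norm v ->
  complete_norm v ->
  (exists p : nat, p \in [pchar (residue_field v)]) ->
  exists P : {poly K},
    (2 < size P)%N /\
    exists U : set (berk_proj_line v),
      nontrivial_wandering (poly_act P) U /\ berk_rational_disk U.
Proof.
move=> v_nt v_compl [p /residue_pchar_lt1[p_prime vp]].
have [P [z0 [e [beta [a [b [[sP e0 ab] [itin aper near_disk expand]]]]]]]] :=
  exists_wandering_disk v_nt v_compl p_prime vp.
have ve : 0 < v e by rewrite unorm_gt0.
exists P; split => //.
exists (Some @` [set x : berk_line v | x ('X - z0%:P) < v e]).
have itin' n : (forall w, v (w - z0) < v e -> v (iter n (horner P) w) <= a) \/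
    (forall w, v (w - z0) < v e -> v (iter n (horner P) w) = b).
  by case: (itin n) => h; [left|right] => w /ltW/h.
have aper' n0 d : (0 < d)%N -> exists n, [/\ (n0 <= n)%N,
    forall w, v (w - z0) < v e -> v (iter n (horner P) w) = b &
    forall w, v (w - z0) < v e -> v (iter (n + d) (horner P) w) <= a].
  move=> /(aper n0)[n [nn0 hb ha]].
  by exists n; split=> // w /ltW; [exact: hb|exact: ha].
split; first split.
- apply: (disk_fatou_component v_nt expand ve near_disk).
  exact: (disk_sub_fatou v_nt ab itin').
- exact: (disk_wandering v_nt ab aper').
- exact: (disk_nontrivial v_nt ab itin' aper').
(* The disk is already affine, so the identity is taken as the Möbius transformation. *)
exists 1, 0, 0, 1, [set z | v (z - z0) < v e]; split.
- by rewrite mulr1 mulr0 subr0 oner_neq0.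
- by exists z0, (v e); split=> //; exists e.
apply/seteqP; split=> [[z|] [x xD xz]|_ [_ [z zD <-] <-]].
- exists (Some z).
    exists z => //; rewrite /= -(berk_eval_linear (v := v)).
    by case: xz => <-.
  by rewrite /= mul0r add0r oner_eq0 mul1r addr0 divr1.
- by [].
rewrite /= mul0r add0r oner_eq0 mul1r addr0 divr1.
by exists (berk_eval v z) => //=; rewrite /berk_eval /= !hornerE.
Qed.
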